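(* Let $p,q\in\mathbb{R}$ be such that $p>-1$, $q>-2$ and $$ r:=\frac{q+2}{p+1}\ge 1 . $$ Suppose that there exists a constant $C$ such that $$ \left(\int_{\Omega}|x|^q\,dx\right)^{\frac{p+1}{q+2}}\le C\int_{\partial\Omega}|x|^p\,d\sigma(x) $$ holds for all bounded open smooth sets $\Omega\subset\mathbb{R}^2$. Then, with $\gamma=q/r$, $\alpha=p$ and the same constant $C$, $$ \big\|u\,|x|^{\gamma}\big\|_{L^r(\mathbb{R}^2)}\le C\,\big\|Du\,|x|^{\alpha}\big\|_{L^1(\mathbb{R}^2)}\qquad\text{for all }u\in C_c^{\infty}(\mathbb{R}^2). $$
   Context: $C_c^\infty(\mathbb{R}^2)$ is the space of smooth (real-valued) functions with compact support on $\mathbb{R}^2$; $Du=\nabla u$ is the gradient, measured in the Euclidean norm. $d\sigma$ is the $1$-dimensional Hausdorff measure. A smooth set is an open set with smooth boundary; such sets are not required to be connected or to contain the origin. *)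

(* Defs.v *)
From HB Require Import structures.
From mathcomp Require Import all_boot all_order all_algebra.
From mathcomp Require Import all_classical all_reals all_analysis.

Set Implicit Arguments.
Unset Strict Implicit.
Unset Printing Implicit Defensive.

Import Order.TTheory GRing.Theory Num.Theory.
Import numFieldNormedType.Exports.

Local Open Scope classical_set_scope.
Local Open Scope ring_scope.

(* The plane is [R * R].  Its library norm is the sup norm, which induces the
   right topology and bounded sets; lengths are measured with [enorm]. *)
Definition enorm {R : realType} (x : R * R) : R :=
  Num.sqrt (x.1 ^+ 2 + x.2 ^+ 2).

(* [measurableTypeR R] is [R] with the Borel sigma-algebra. *)
Definition lebesgue2 {R : realType} :
    {measure set (measurableTypeR R * measurableTypeR R) -> \bar R} :=
  (@lebesgue_measure R \x @lebesgue_measure R)%E.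

Definition boundary {T : topologicalType} (A : set T) : set T :=
  closure A `\` interior A.

Section calculus.
Context {R : realType}.
Implicit Types u : R * R -> R.

Definition partial1 u (x : R * R) : R := 'D_(1, 0) u x.
Definition partial2 u (x : R * R) : R := 'D_(0, 1) u x.

Definition grad u (x : R * R) : R * R := (partial1 u x, partial2 u x).

Fixpoint Ck (k : nat) u : Prop :=
  if k is k'.+1 then
    [/\ forall x, differentiable u x, Ck k' (partial1 u) & Ck k' (partial2 u)]
  else continuous u.

Definition smooth u : Prop := forall k, Ck k u.

Definition compactly_supported u : Prop := compact (closure [set x | u x != 0]).

(* Meaningful for open [I], where each iterated derivative at a point of [I]
   only depends on the values of [g] in [I]. *)
Definition smooth_on (I : set R) (g : R -> R) : Prop :=
  forall (n : nat) (t : R), I t -> derivable (derive1n n g) t 1.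

(* Near each boundary point x0, after a rotation of the axes (onto the
   orthonormal frame (a, b), (- b, a)), A is the region strictly above the
   graph of a C^oo function g.  Only the values of g at distance < rho from
   the first new coordinate of x0 matter. *)
Definition smooth_boundary (A : set (R * R)) : Prop :=
  forall x0, boundary A x0 ->
  exists (a b rho : R) (g : R -> R),
    [/\ a ^+ 2 + b ^+ 2 = 1, 0 < rho,
        smooth_on (ball (a * x0.1 + b * x0.2) rho) g &
        forall x, enorm (x - x0) < rho ->
          (A x <-> g (a * x.1 + b * x.2) < - b * x.1 + a * x.2)].

Definition smooth_set (A : set (R * R)) : Prop := open A /\ smooth_boundary A.

End calculus.

(* One-dimensional Hausdorff measure on the plane. *)
Section hausdorff.
Context {R : realType}.
Local Open Scope ereal_scope.
Implicit Types A : set (R * R).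

(* The extra point 0 only matters for the empty set, whose diameter is 0. *)
Definition diam A : \bar R :=
  ereal_sup (0 |` [set (enorm (x - y)%R)%:E | x in A & y in A]).

Definition small_cover (delta : R) A : set ((set (R * R))^nat) :=
  [set E | (forall i, diam (E i) <= delta%:E) /\ A `<=` \bigcup_i E i].

Definition hausdorff1_delta (delta : R) A : \bar R :=
  ereal_inf [set \sum_(i <oo) diam (E i) | E in small_cover delta A].

Definition hausdorff1 A : \bar R :=
  ereal_sup [set hausdorff1_delta delta A | delta in [set d : R | (0 < d)%R]].

Lemma diam_ge0 A : 0 <= diam A.
Proof. by apply: ereal_sup_ubound; left. Qed.

Lemma diam0 : diam set0 = 0.
Proof.
apply/eqP; rewrite eq_le diam_ge0 andbT.
by apply: ge_ereal_sup => _ [->//|[x []]].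
Qed.

(* [hausdorff1_delta] as an instance of the library's [mu_ext], all subsets of
   the plane being measurable. *)
Let discrete := g_sigma_algebraType [set: set (R * R)].

Let small_diam (delta : R) (A : set discrete) : \bar R :=
  if diam A <= delta%:E then diam A else +oo.

Let small_diam_ge0 delta A : 0 <= small_diam delta A.
Proof. by rewrite /small_diam; case: ifP => // _; exact: diam_ge0. Qed.

Let small_diam0 delta : (0 < delta)%R -> small_diam delta set0 = 0.
Proof. by move=> d0; rewrite /small_diam diam0 lee_fin ltW. Qed.

Let hausdorff1_deltaE delta : hausdorff1_delta delta = mu_ext (small_diam delta).
Proof.
apply/funext => A; apply/eqP; rewrite eq_le; apply/andP; split.
- apply: le_ereal_inf_tmp => _ [F [_ AF] <-].
  have [sF|] := pselect (forall i, diam (F i) <= delta%:E).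
    apply: ereal_inf_lbound; exists F => //.
    by apply: eq_eseriesr => i _; rewrite /small_diam sF.
  move=> /existsNP[i /negP Fi].
  rewrite (@eseries_pinfty _ _ xpredT i) ?leey//.
    by move=> n _; rewrite -ltNye (lt_le_trans _ (small_diam_ge0 _ _)).
  by rewrite /small_diam (negbTE Fi).
- apply: le_ereal_inf_tmp => _ [F [sF AF] <-].
  apply: ereal_inf_lbound; exists F.
    by split => // i; exact: sub_sigma_algebra.
  by apply: eq_eseriesr => i _; rewrite /small_diam sF.
Qed.

Lemma hausdorff1_ge_delta delta A : (0 < delta)%R ->
  hausdorff1_delta delta A <= hausdorff1 A.
Proof. by move=> d0; apply: ereal_sup_ubound; exists delta. Qed.

Lemma hausdorff1_ge0 A : 0 <= hausdorff1 A.
Proof.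
apply: le_trans (hausdorff1_ge_delta A (@ltr01 R)).
by rewrite hausdorff1_deltaE; exact: mu_ext_ge0.
Qed.

Lemma hausdorff1_set0 : hausdorff1 set0 = 0.
Proof.
apply/eqP; rewrite eq_le hausdorff1_ge0 andbT.
apply: ge_ereal_sup => _ [delta d0 <-].
by rewrite hausdorff1_deltaE mu_ext0//; exact: small_diam0.
Qed.

Lemma le_hausdorff1 : {homo hausdorff1 : A B / A `<=` B >-> A <= B}.
Proof.
move=> A B AB; apply: ge_ereal_sup => _ [delta d0 <-].
apply: le_trans (hausdorff1_ge_delta B d0).
by rewrite hausdorff1_deltaE; exact: le_mu_ext.
Qed.

Lemma hausdorff1_sigma_subadditive : sigma_subadditive hausdorff1.
Proof.
move=> F; apply: ge_ereal_sup => _ [delta d0 <-].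
apply: (@le_trans _ _ (\sum_(i <oo) hausdorff1_delta delta (F i))).
  by rewrite hausdorff1_deltaE; apply: mu_ext_sigma_subadditive => //;
     exact: small_diam0.
apply: lee_nneseries => i *; last exact: hausdorff1_ge_delta.
by rewrite hausdorff1_deltaE; exact: mu_ext_ge0.
Qed.

HB.instance Definition _ := isOuterMeasure.Build R (R * R)%type hausdorff1
  hausdorff1_set0 hausdorff1_ge0 le_hausdorff1 hausdorff1_sigma_subadditive.

End hausdorff.

(* The restriction of an outer measure to its Caratheodory-measurable sets. *)
Definition caratheodory_measure {R : realType} {T : pointedType}
  (mu : {outer_measure set T -> \bar R}) :
  {measure set (caratheodory_type mu) -> \bar R} := mu.

Definition hausdorff1_measure {R : realType} :=
  caratheodory_measure (@hausdorff1 R).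

(* Main.v *)
Require Import Defs.
From mathcomp Require Import all_boot all_order all_algebra.
From mathcomp Require Import all_classical all_reals all_analysis.
From HB Require Import structures.
From mathcomp Require Import measurable_realfun ring lra.
Import Order.TTheory GRing.Theory Num.Theory.
Import numFieldNormedType.Exports.
Local Open Scope classical_set_scope.
Local Open Scope ring_scope.
Set Implicit Arguments.
Unset Strict Implicit.
Unset Printing Implicit Defensive.

(** The function |u| is the integral over t > 0 of the indicators of its
    superlevel sets {|u| > t}. By Minkowski's inequality for this integral, in
    L^r with respect to |x|^q dx, the left-hand side is at most the integral over
    t of the r-th roots of the weighted areas of the superlevel sets. The
    isoperimetric inequality bounds each of these roots by C times the weighted
    length of the boundary, which lies in the level set {|u| = t}, and the coarea
    inequality bounds the integral over t of these lengths by the integral of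
    |Du| |x|^p.

    The isoperimetric inequality applies to almost every t. By Sard's theorem
    (lemma sard) almost every t > 0 is a regular value of u and of - u. At a
    boundary point of {|u| > t} the implicit function theorem (level_curve) then
    gives a graph, smooth because the derivative of the implicit function lies in
    a class of functions closed under differentiation (curve_fun_derive). This is
    smooth_superlevel.

    Only one half of the coarea formula is needed, with constant 1: the integral
    over t of the weighted lengths is at most the weighted integral of |Du|
    (coarea_inequality). It is proved on small squares, on which u is nearly
    affine. In the direction where its derivative does not vanish, the level sets
    are graphs (level_set_graph). Cut the square into thin strips across the
    graphs: a strip is met by the levels of an interval whose length is nearly
    the oscillation of u along the strip, and the trace of each level on it has
    an explicitly bounded diameter (level_set_strip_bound). As the width of the
    strips tends to 0, the diameters bound the Hausdorff measure
    (square_coarea). By compactness all squares of a fine grid that meet a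
    regular level satisfy this bound up to a factor 1 + eps, and eps is
    arbitrary. Upper bounds of the lengths suffice because C is nonnegative
    (isoperimetric_constant_ge0).

    Sard's theorem comes from the same two tools. Where some second derivative
    of u is nonzero, the critical points lie on the level curve of a first
    derivative, which is a Lipschitz graph, and the increments of u between them
    are quadratic (sard_curve); where the second derivatives vanish, u varies by
    o(h^2) on a square of side h around a critical point (sard_flat).

    Minkowski's inequality is derived from Hoelder's (minkowski_layer_cake). That
    argument divides by a power of the norm, so it is run with |x|^q truncated
    at n, and Fatou's lemma lets n tend to infinity. *)

(** * Differential calculus in the plane *)

Section plane_calculus.
Context {R : realType}.
Implicit Types (x y z : R * R) (u : R * R -> R).

Lemma ball_prodE x (e : R) y :
  ball x e y <-> `|x.1 - y.1| < e /\ `|x.2 - y.2| < e.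
Proof. by []. Qed.

Lemma derive_plane u x (v : R * R) : differentiable u x ->
  'D_v u x = v.1 * partial1 u x + v.2 * partial2 u x.
Proof.
move=> du; rewrite /partial1 /partial2 !deriveE//.
rewrite [in LHS](_ : v = v.1 *: (1, 0) + v.2 *: (0, 1)); last first.
  case: v => a b; apply: injective_projections => /=;
    by rewrite /GRing.scale /= ?mulr1 ?mulr0 ?addr0 ?add0r.
by rewrite linearD !linearZ.
Qed.

Lemma is_derive_segment u x (v : R * R) (s : R) : differentiable u (x + s *: v) ->
  is_derive s 1 (fun t => u (x + t *: v)) ('D_v u (x + s *: v)).
Proof.
move=> /diff_derivable du.
have E : (fun h : R => h^-1 *: (u (x + (h *: 1 + s) *: v) - u (x + s *: v))) =
    (fun h : R => h^-1 *: (u (h *: v + (x + s *: v)) - u (x + s *: v))).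
  by apply/funext => h; rewrite [h *: 1]mulr1 scalerDl addrCA.
apply: DeriveDef; last by rewrite /derive /= [X in lim (X @ _)]E.
by rewrite /derivable /= E; exact: du.
Qed.

Lemma plane_MVT u x y : (forall z, differentiable u z) ->
  exists2 s : R, 0 <= s <= 1 & let z := x + s *: (y - x) in
    u y - u x = (y.1 - x.1) * partial1 u z + (y.2 - x.2) * partial2 u z.
Proof.
move=> du.
have h (s : R) : is_derive s 1 (fun t => u (x + t *: (y - x)))
    ('D_(y - x) u (x + s *: (y - x))) by exact: is_derive_segment.
have [] := @MVT_segment R (fun t => u (x + t *: (y - x)))
  (fun s => 'D_(y - x) u (x + s *: (y - x))) 0 1 ler01 (fun s _ => h s).
  by apply: derivable_within_continuous => s _; exact: ex_derive.
move=> s; rewrite in_itv /= => s01; rewrite subr0 mulr1 scale1r scale0r addr0 subrKC.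
by move=> E; exists s => //; rewrite E derive_plane.
Qed.

Lemma ball_convex x y c (e s : R) : 0 <= s <= 1 -> ball c e x -> ball c e y ->
  ball c e (x + s *: (y - x)).
Proof.
have K (a b d : R) : 0 <= s <= 1 -> `|d - a| < e -> `|d - b| < e ->
    `|d - (a + s * (b - a))| < e.
  move=> /andP[s0 s1] ae be.
  have -> : d - (a + s * (b - a)) = (1 - s) * (d - a) + s * (d - b) by ring.
  apply: (le_lt_trans (ler_normD _ _)).
  rewrite !normrM [ `|s| ]ger0_norm// [ `|1 - s| ]ger0_norm ?subr_ge0//.
  have [->|sN0] := eqVneq s 0; first by rewrite mul0r addr0 subr0 mul1r.
  have : s * `|d - b| < s * e by rewrite ltr_pM2l// lt0r sN0.
  have : (1 - s) * `|d - a| <= (1 - s) * e by apply: ler_wpM2l; [rewrite subr_ge0|exact: ltW].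
  lra.
by move=> s01 [x1 x2] [y1 y2]; split => /=; exact: K.
Qed.

Lemma continuous_of_Ck k u : Ck k u -> continuous u.
Proof. by case: k => [//|k] [du _ _] x; exact: differentiable_continuous. Qed.

Lemma smooth_partial1 u : smooth u -> smooth (partial1 u).
Proof. by move=> su k; have [] := su k.+1. Qed.

Lemma smooth_partial2 u : smooth u -> smooth (partial2 u).
Proof. by move=> su k; have [] := su k.+1. Qed.

Lemma partial1N u : (forall x, differentiable u x) ->
  partial1 (\- u) = \- partial1 u.
Proof.
by move=> du; apply/funext => x; rewrite /partial1 deriveN//; exact: diff_derivable.
Qed.

Lemma partial2N u : (forall x, differentiable u x) ->
  partial2 (\- u) = \- partial2 u.
Proof.
by move=> du; apply/funext => x; rewrite /partial2 deriveN//; exact: diff_derivable.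
Qed.

Lemma CkN k u : Ck k u -> Ck k (\- u).
Proof.
elim: k u => [|k IH] u /=; first by move=> cu x; apply: continuousN; exact: cu.
move=> [du c1 c2]; split; [|by rewrite partial1N//; exact: IH
  |by rewrite partial2N//; exact: IH].
by move=> x; apply: differentiableN; exact: du.
Qed.

Lemma smoothN u : smooth u -> smooth (\- u).
Proof. by move=> su k; apply: CkN. Qed.

Lemma enorm_ge0 x : 0 <= enorm x. Proof. exact: sqrtr_ge0. Qed.

Lemma sqr_enorm x : enorm x ^+ 2 = x.1 ^+ 2 + x.2 ^+ 2.
Proof. by rewrite sqr_sqrtr// addr_ge0 ?sqr_ge0. Qed.

Lemma enorm_eq0 x : (enorm x == 0) = (x == 0).
Proof.
rewrite sqrtr_eq0; case: x => a b /=; apply/idP/eqP => [h|[-> ->]]; last first.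
  by rewrite !expr0n addr0.
have a0 := sqr_ge0 a; have b0 := sqr_ge0 b.
by congr (_, _); apply/eqP; rewrite -sqrf_eq0 eq_le ?a0 ?b0 andbT; lra.
Qed.

Lemma enorm_gt0 x : (0 < enorm x) = (x != 0).
Proof. by rewrite lt0r enorm_ge0 andbT enorm_eq0. Qed.

Lemma continuous_enorm : continuous (enorm : R * R -> R).
Proof.
move=> x; apply: (@continuous_comp _ _ _ (fun x : R * R => x.1 ^+ 2 + x.2 ^+ 2) Num.sqrt).
  by apply: cvgD; [apply: (@continuous_comp _ _ _ fst (fun t : R => t ^+ 2))
    |apply: (@continuous_comp _ _ _ snd (fun t : R => t ^+ 2))];
    [exact: cvg_fst|exact: exprn_continuous|exact: cvg_snd|exact: exprn_continuous].
exact: sqrt_continuous.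
Qed.

Lemma abs1_le_enorm x : `|x.1| <= enorm x.
Proof.
by rewrite -ler_sqr ?nnegrE ?enorm_ge0// sqr_enorm -normrX ger0_norm ?sqr_ge0// lerDl sqr_ge0.
Qed.

Lemma abs2_le_enorm x : `|x.2| <= enorm x.
Proof.
by rewrite -ler_sqr ?nnegrE ?enorm_ge0// sqr_enorm -normrX ger0_norm ?sqr_ge0// lerDr sqr_ge0.
Qed.

End plane_calculus.

Section coordinates.
Context {R : realType}.
Implicit Types (x y z : R * R) (u : R * R -> R) (b : bool).

Definition coor b x : R := if b then x.1 else x.2.
Definition partial b u : R * R -> R := if b then partial1 u else partial2 u.

Lemma Ck_partial b k u : Ck k.+1 u -> Ck k (partial b u).
Proof. by case: b => -[]. Qed.

Lemma Ck1_differentiable k u x : Ck k.+1 u -> differentiable u x.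
Proof. by case. Qed.

Lemma Ck1_continuous b k u : Ck k.+1 u -> continuous (partial b u).
Proof. by move=> /(Ck_partial b); exact: continuous_of_Ck. Qed.

Lemma coord_le_enorm b x : `|coor b x| <= enorm x.
Proof. by case: b; [exact: abs1_le_enorm|exact: abs2_le_enorm]. Qed.

Lemma sqr_enorm_coord b x : enorm x ^+ 2 = coor b x ^+ 2 + coor (~~ b) x ^+ 2.
Proof. by rewrite sqr_enorm; case: b => //=; rewrite addrC. Qed.

Lemma coordB b x y : coor b (x - y) = coor b x - coor b y.
Proof. by case: b. Qed.

Lemma ball_coord x (e : R) y : ball x e y <-> forall b, `|coor b x - coor b y| < e.
Proof.
rewrite ball_prodE; split; first by move=> [? ?] [].
by move=> h; split; [exact: (h true)|exact: (h false)].
Qed.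

(** The intermediate point stays in any ball containing the endpoints, and its
    coordinates stay between theirs; the second fact lets [critical_taylor]
    apply the mean value theorem twice. *)
Lemma ball_MVT u b c (e : R) x y : (forall z, differentiable u z) ->
  ball c e x -> ball c e y ->
  exists z, [/\ ball c e z, forall b', `|coor b' z - coor b' x| <= `|coor b' y - coor b' x| &
    u y - u x = (coor b y - coor b x) * partial b u z +
      (coor (~~ b) y - coor (~~ b) x) * partial (~~ b) u z].
Proof.
move=> du cx cy; have [s s01 E] := plane_MVT x y du.
exists (x + s *: (y - x)); split; first exact: ball_convex.
  move: s01 => /andP[s0 s1].
  have K (p q : R) : `|p + s * (q - p) - p| <= `|q - p|.
    by rewrite addrAC subrr add0r normrM ger0_norm// ler_piMl.
  by case; exact: K.
by case: b; [exact: E|rewrite [RHS]addrC; exact: E].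
Qed.

Lemma continuous_grad_norm u : Ck 1 u -> continuous (fun z => enorm (grad u z)).
Proof.
move=> [_ c1 c2] z.
apply: (@continuous_comp _ _ _ (grad u) enorm); last exact: continuous_enorm.
exact: (cvg_pair (c1 z) (c2 z)).
Qed.

(** By the mean value theorem two points of a level set differ by a vector
    orthogonal to some intermediate gradient. So near [x] the level sets are
    graphs over the coordinate [b], and [c] may be any number above the value at
    [x] of the length of a tangent vector per unit of that coordinate: this
    sharpness is what yields the coarea inequality without loss. *)
Lemma level_set_graph u b x (c : R) : Ck 1 u ->
  enorm (grad u x) < c * `|partial (~~ b) u x| ->
  \forall e \near 0^'+, forall y z, ball x e y -> ball x e z -> u y = u z ->
    enorm (y - z) <= c * `|coor b y - coor b z|.
Proof.
move=> cu h.
have : \forall z \near x, enorm (grad u z) < c * `|partial (~~ b) u z|.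
  have cQ : partial (~~ b) u z @[z --> x] --> partial (~~ b) u x.
    exact: (Ck1_continuous cu).
  have cont : c * `|partial (~~ b) u z| - enorm (grad u z) @[z --> x] -->
      c * `|partial (~~ b) u x| - enorm (grad u x).
    apply: cvgB; last exact: (continuous_grad_norm cu).
    by apply: cvgM; [exact: cvg_cst|exact: cvg_norm].
  have : 0 < c * `|partial (~~ b) u x| - enorm (grad u x) by rewrite subr_gt0.
  by move=> /(cvgr_gt _ cont); apply: filterS => z; rewrite subr_gt0.
move=> /nbhs_ballP[e /= e0 He].
near=> d => y z dy dz uyz.
have de : d <= e by near: d; exact: nbhs_right_le.
have [w [/(le_ball de)/He]] := ball_MVT b (fun z => Ck1_differentiable z cu) dz dy.
move=> + _; rewrite uyz subrr => + /esym/eqP.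
have := sqr_enorm_coord b (grad u w).
have -> : coor b (grad u w) = partial b u w by case: b {h He}.
have -> : coor (~~ b) (grad u w) = partial (~~ b) u w by case: b {h He}.
set P := partial b u w; set Q := partial (~~ b) u w.
have := sqr_enorm_coord b (y - z); rewrite !coordB.
set s := coor b y - coor b z; set t := coor _ y - coor _ z.
set n := enorm (y - z); set m := enorm _ => En Em mQ E.
have m0 : 0 <= m by exact: enorm_ge0.
have cQ : 0 < c * `|Q| := le_lt_trans m0 mQ.
have c0 : 0 < c.
  by rewrite ltNge; apply/negP => c0; move: cQ; rewrite ltNge mulr_le0_ge0.
have Q0 : 0 < `|Q| by rewrite -(pmulr_rgt0 _ c0).
have ? : 0 <= n by exact: enorm_ge0.
have c0' := ltW c0.
rewrite -ler_sqr ?nnegrE ?mulr_ge0//.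
rewrite En exprMn real_normK ?num_real//.
have mQ2 : m ^+ 2 <= (c * `|Q|) ^+ 2 by rewrite ler_sqr ?nnegrE// ltW.
move: mQ2; rewrite Em exprMn real_normK ?num_real// => mQ2.
have Q2 : 0 < Q ^+ 2 by rewrite -[Q ^+ 2]real_normK ?num_real// exprn_gt0.
rewrite -(ler_pM2r Q2).
have tQ : t ^+ 2 * Q ^+ 2 = s ^+ 2 * P ^+ 2.
  by rewrite -!exprMn; move: E; rewrite addr_eq0 => /eqP ->; rewrite sqrrN.
have := ler_wpM2l (sqr_ge0 s) mQ2; rewrite mulrDl tQ; lra.
Unshelve. all: by end_near. Qed.

Lemma lipschitz_near u b x (A B : R) : Ck 1 u ->
  `|partial b u x| < A -> `|partial (~~ b) u x| < B ->
  \forall e \near 0^'+, forall y z, ball x e y -> ball x e z ->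
    `|u y - u z| <= A * `|coor b y - coor b z| + B * `|coor (~~ b) y - coor (~~ b) z|.
Proof.
move=> cu hA hB.
have : \forall z \near x, `|partial b u z| < A /\ `|partial (~~ b) u z| < B.
  have cp b' : partial b' u z @[z --> x] --> partial b' u x.
    exact: (Ck1_continuous cu).
  by apply: filterI; [exact: (cvgr_norm_lt _ (cp _) _ hA)|exact: (cvgr_norm_lt _ (cp _) _ hB)].
move=> /nbhs_ballP[e /= e0 He].
near=> d => y z dy dz.
have de : d <= e by near: d; exact: nbhs_right_le.
have [w [/(le_ball de)/He[wA wB] _ ->]] := ball_MVT b (fun z => Ck1_differentiable z cu) dz dy.
apply: (le_trans (ler_normD _ _)); rewrite !normrM.
by apply: lerD; rewrite mulrC ler_wpM2r// ltW.
Unshelve. all: by end_near. Qed.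

(** The increment of [u] from a critical point is [d] times the gradient at an
    intermediate point, which is itself an increment of order [M * d]. *)
Lemma critical_taylor u c (e M : R) x y (d : R) : Ck 2 u ->
  (forall b b' z, ball c e z -> `|partial b (partial b' u) z| <= M) ->
  ball c e x -> ball c e y -> grad u x = 0 ->
  (forall b, `|coor b y - coor b x| <= d) ->
  `|u y - u x| <= 4 * M * d ^+ 2.
Proof.
move=> cu HM cx cy g0 hd.
have d0 : 0 <= d := le_trans (normr_ge0 _) (hd true).
have M0 : 0 <= M := le_trans (normr_ge0 _) (HM true true _ cx).
have [w [cw wd ->]] := ball_MVT true (fun z => Ck1_differentiable z cu) cx cy.
have p0 b : partial b u x = 0 by move: g0 => [g1 g2]; case: b.
have K b : `|partial b u w| <= 2 * M * d.
  have := ball_MVT true (fun z => Ck1_differentiable z (Ck_partial b cu)) cx cw.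
  move=> [w' [cw' _]]; rewrite p0 subr0 => ->.
  apply: (le_trans (ler_normD _ _)); rewrite !normrM.
  have -> : 2 * M * d = d * M + d * M by ring.
  by apply: lerD; apply: ler_pM => //; rewrite ?HM//; exact: le_trans (wd _) (hd _).
apply: (le_trans (ler_normD _ _)); rewrite !normrM.
have -> : 4 * M * d ^+ 2 = d * (2 * M * d) + d * (2 * M * d) by ring.
by apply: lerD; apply: ler_pM => //; rewrite ?hd.
Qed.

End coordinates.

(** * Length of level sets in a square *)

Section partition.
Context {R : realType}.

Lemma exists_cell (a l x : R) (n : nat) : 0 < l -> (0 < n)%N -> a <= x < a + l ->
  exists i : 'I_n, a + i%:R * (l / n%:R) <= x < a + i%:R * (l / n%:R) + l / n%:R.
Proof.
move=> l0 n0 /andP[ax xa]; have n0' : 0 < n%:R :> R by rewrite ltr0n.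
have c0 : 0 < l / n%:R by rewrite divr_gt0.
have y0 : 0 <= (x - a) / (l / n%:R) by rewrite divr_ge0 ?subr_ge0// ltW.
have /andP[k1 k2] := truncn_itv y0; set k := Num.truncn _ in k1 k2.
rewrite ler_pdivlMr// in k1; rewrite ltr_pdivrMr// in k2.
have kn : (k < n)%N.
  rewrite -(ltr_nat R) -(ltr_pM2r c0); apply: le_lt_trans k1 _.
  by rewrite mulrCA divff ?gt_eqF// mulr1 ltrBlDl.
exists (Ordinal kn) => /=.
rewrite -natr1 mulrDl mul1r in k2.
by apply/andP; split; [rewrite -lerBrDl|rewrite -addrA -ltrBlDl].
Qed.

Lemma near_scaled_harmonic_lt (c e : R) : 0 < e ->
  \forall n \near \oo, c * n.+1%:R^-1 < e.
Proof.
move=> e0; have : (c * n.+1%:R^-1) @[n --> \oo] --> (c * 0).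
  by apply: cvgM; [exact: cvg_cst|exact: cvg_harmonic].
by rewrite mulr0 => /cvgr_lt /(_ _ e0).
Qed.

End partition.

Section liminf.
Local Open Scope ereal_scope.
Context {R : realType}.
Implicit Types u : (\bar R)^nat.

Lemma limn_einf_ge u (a : \bar R) : (\forall n \near \oo, a <= u n) -> a <= limn_einf u.
Proof.
move=> [N _ aN]; rewrite limn_einf_lim; apply: lime_ge; first exact: is_cvg_einfs.
exists N => // n /= Nn; apply: le_ereal_inf_tmp => _ [m /= nm <-].
by apply: aN => /=; exact: leq_trans nm.
Qed.

Lemma limn_einf_le u (b : \bar R) : (forall n, u n <= b) -> limn_einf u <= b.
Proof.
move=> ub; rewrite limn_einf_lim; apply: lime_le; first exact: is_cvg_einfs.
apply: nearW => n; apply: le_trans (ub n).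
by apply: ereal_inf_lbound; exists n => /=.
Qed.

Lemma measurable_limn_einf d (T : measurableType d) (f : (T -> \bar R)^nat) :
  (forall n, measurable_fun setT (f n)) ->
  measurable_fun setT (fun x => limn_einf (f ^~ x)).
Proof.
move=> mf; apply: (measurableT_comp (f := -%E)) => //.
apply: (measurable_fun_limn_esup (f := fun n x => - f n x)) => n.
exact: (measurableT_comp (f := -%E)).
Qed.

End liminf.

Section hausdorff_bounds.
Context {R : realType}.
Local Open Scope ereal_scope.
Implicit Types (A E : set (R * R)).

Lemma diam_le E (D : \bar R) : 0 <= D ->
  (forall x y, E x -> E y -> (enorm (x - y)%R)%:E <= D) -> diam E <= D.
Proof.
move=> D0 h; apply: ge_ereal_sup => _ [->//|[x Ex [y Ey <-]]].
exact: h.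
Qed.

(** Finite covers are padded with empty sets, of diameter 0. *)
Lemma hausdorff1_delta_le (delta : R) (n : nat) (E : 'I_n -> set (R * R)) A
    (d : 'I_n -> R) : (0 < delta)%R ->
  (forall i, (d i <= delta)%R) -> (forall i, (0 <= d i)%R) ->
  (forall i, diam (E i) <= (d i)%:E) -> A `<=` \bigcup_i E i ->
  hausdorff1_delta delta A <= (\sum_i d i)%:E.
Proof.
move=> delta0 dd d0 Ed AE.
pose F (k : nat) := if insub k is Some i then E i else set0.
have F_diam (i : 'I_n) : diam (F i) <= (d i)%:E.
  by rewrite /F insubT//= => ?; rewrite (_ : Sub _ _ = i)//; exact: val_inj.
have F0 k : (n <= k)%N -> F k = set0 by move=> nk; rewrite /F insubF// ltnNge nk.
apply: (@le_trans _ _ (\sum_(k <oo) diam (F k))).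
  apply: ereal_inf_lbound; exists F => //; split => [k|x /AE[i _ Ex]].
    have [kn|nk] := ltnP k n.
      by apply: (le_trans (F_diam (Ordinal kn))); rewrite lee_fin.
    by rewrite F0// diam0 lee_fin ltW.
  by exists i => //; rewrite /F valK.
rewrite (nneseries_split 0 n); last by move=> k _; exact: diam_ge0.
rewrite add0n (@eseries0 _ _ n)%N; last by move=> k nk _; rewrite F0// diam0.
rewrite adde0 big_mkord -sumEFin; apply: lee_sum => i _; exact: F_diam.
Qed.


(** Half-open, so that the squares of a grid are disjoint. *)
Definition square (c : R * R) (h : R) : set (R * R) :=
  [set x | forall b, (coor b c <= coor b x < coor b c + h)%R].

Lemma square_exhaust (x : R * R) :
  exists n : nat, square (- n.+1%:R, - n.+1%:R)%R (2 * n.+1%:R)%R x.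
Proof.
have x1 := normr_ge0 x.1; have x2 := normr_ge0 x.2.
pose n := Num.truncn (`|x.1| + `|x.2|)%R.
have xn : (`|x.1| + `|x.2| < n.+1%:R)%R by have /andP[] := truncn_itv (addr_ge0 x1 x2).
have : (`|x.1| < n.+1%:R)%R by lra.
have : (`|x.2| < n.+1%:R)%R by lra.
by rewrite !ltr_norml => ? ?; exists n; case => /=; lra.
Qed.

Definition point_of b (s t : R) : R * R := if b then (s, t) else (t, s).

Lemma coord_point_of b s t : coor b (point_of b s t) = s.
Proof. by case: b. Qed.

Lemma coord_point_ofN b s t : coor (~~ b) (point_of b s t) = t.
Proof. by case: b. Qed.

(** Centre of the i-th of the N strips of width h / N on which the coordinate
    [b] is nearly constant. *)
Let strip_center b c (h : R) (N i : nat) : R * R :=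
  point_of b (coor b c + i%:R * (h / N%:R) + h / N%:R / 2)%R
             (coor (~~ b) c + h / 2)%R.

(** A strip is met by the level t only if t is within (A h / N + B h) / 2 of the
    value of [V] at its centre, and the piece of level set in it has diameter at
    most L h / N. The function [S] adds up these bounds: it is a step function of
    t, so its integral is explicit. *)
Lemma level_set_strip_bound b c (h L A B : R) (V : R * R -> R) (N : nat) :
  (0 < h)%R -> (0 <= L)%R -> (0 <= A)%R -> (0 <= B)%R -> (0 < N)%N ->
  (forall y z, square c h y -> square c h z -> V y = V z ->
    (enorm (y - z) <= L * `|coor b y - coor b z|)%R) ->
  (forall y z, square c h y -> square c h z -> (`|V y - V z| <=
    A * `|coor b y - coor b z| + B * `|coor (~~ b) y - coor (~~ b) z|)%R) ->
  exists S : measurableTypeR R -> R,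
    [/\ measurable_fun setT S, forall t, (0 <= S t)%R,
      \int[lebesgue_measure]_t (S t)%:E = (L * B * h ^+ 2 + (A * L * h ^+ 2) / N%:R)%:E &
      forall (delta t : R) E, (0 < delta)%R -> (L * (h / N%:R) <= delta)%R ->
        E `<=` square c h -> (forall y, E y -> V y = t) ->
        hausdorff1_delta delta E <= (S t)%:E].
Proof.
move=> h0 L0 A0 B0 N0 HL HAB.
pose w := (h / N%:R)%R; pose rho := ((A * w + B * h) / 2)%R.
have N0' : (0 < N%:R :> R)%R by rewrite ltr0n.
have w0 : (0 < w)%R by rewrite divr_gt0.
have rho0 : (0 <= rho)%R by rewrite divr_ge0// addr_ge0// mulr_ge0// ltW.
pose m i := strip_center b c h N i.
pose I i : set (measurableTypeR R) := `[(V (m i) - rho)%R, (V (m i) + rho)%R]%classic.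
have mI i : measurable (I i) by exact: measurable_itv.
pose S (t : measurableTypeR R) := (\sum_(i < N) L * w * \1_(I i) t)%R.
have mSi i : measurable_fun setT (fun t => (L * w * \1_(I i) t)%R).
  by apply: measurable_funM => //; exact: measurable_indic.
have Lw0 : (0 <= L * w)%R by rewrite mulr_ge0// ltW.
have Si0 i t : (0 <= L * w * \1_(I i) t :> R)%R by rewrite mulr_ge0.
have mc i : (i < N)%N -> square c h (m i).
  move=> iN; have iw : (i%:R * w + w <= h)%R.
    rewrite -[X in (_ + X <= _)%R]mul1r -mulrDl natr1 /w mulrA ler_pdivrMr//.
    by rewrite mulrC ler_pM2l// ler_nat.
  have iw0 : (0 <= i%:R * w)%R by rewrite mulr_ge0// ltW.
  move=> b'; have [->|] := eqVneq b' b.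
    by rewrite /m /strip_center coord_point_of -/w; lra.
  move=> nb; have -> : b' = ~~ b by move: nb; case: b' b {HL HAB m I mI S mSi Si0} => -[].
  by rewrite /m /strip_center coord_point_ofN -/w; lra.
exists S; split.
- by apply: measurable_sum => i; exact: mSi.
- by move=> t; apply: sumr_ge0.
- under eq_integral do rewrite /S -sumEFin.
  rewrite ge0_integral_sum//; last 2 first.
  + by move=> i; apply/measurable_EFinP; exact: mSi.
  + by move=> i t _; rewrite lee_fin.
  rewrite (eq_bigr (fun=> (L * w * (rho *+ 2))%:E)); last first.
    move=> i _; under eq_integral do rewrite EFinM.
    rewrite ge0_integralZl_EFin//; last first.
      by apply/measurable_EFinP; exact: measurable_indic.
    rewrite integral_indic// setIT /I /= lebesgue_measure_itv /= lte_fin.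
    case: ifPn => [_|]; first by rewrite -EFinB -EFinM; congr (_ * _)%:E; ring.
    rewrite -leNgt => h'; have -> : rho = 0%R by lra.
    by rewrite mul0rn mulr0 mule0.
  rewrite sumEFin sumr_const card_ord; congr (_%:E).
  rewrite -mulr_natr /rho /w; field; exact: lt0r_neq0.
move=> delta t E delta0 Ldelta EQ EV.
pose Ei (i : 'I_N) := E `&` [set x | (coor b c + i%:R * w <= coor b x < coor b c + i%:R * w + w)%R].
have -> : (S t)%:E = (\sum_(i < N) (L * w * \1_(I i) t))%R%:E by [].
apply: (hausdorff1_delta_le (E := Ei)) => //.
- move=> i; apply: le_trans Ldelta; rewrite -[leRHS]mulr1 ler_wpM2l//.
- move=> i; apply: diam_le; first by rewrite lee_fin.
  move=> x y [Ex /= xi] [Ey /= yi]; rewrite lee_fin.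
  have -> : \1_(I i) t = 1%R :> R.
    rewrite indicE mem_set// /I /= in_itv /= -!(EV _ Ex) -ler_distlC.
    rewrite distrC; apply: le_trans (HAB _ _ (EQ _ Ex) (mc _ (ltn_ord i))) _.
    rewrite /m /strip_center coord_point_of coord_point_ofN -/w.
    have := EQ _ Ex (~~ b); move=> xn.
    have -> : rho = (A * (w / 2) + B * (h / 2))%R by rewrite /rho; field.
    by apply: lerD; apply: ler_wpM2l => //; rewrite ler_norml; lra.
  rewrite mulr1; apply: le_trans (HL _ _ (EQ _ Ex) (EQ _ Ey) _) _.
    by rewrite !EV.
  by apply: ler_wpM2l => //; rewrite ler_norml; lra.
- move=> x Ex; have [i xi] := exists_cell h0 N0 (EQ _ Ex b).
  by exists i.
Qed.

(** Let the width of the strips of [level_set_strip_bound] tend to 0: the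
    oscillation A h / N of [V] across a strip becomes negligible against its
    oscillation B h along the strip, and Fatou's lemma gives the bound. When [V]
    is nearly affine, L is the length of the gradient divided by its component
    along the other axis and B is that component, so L * B is the length of the
    gradient. *)
Lemma square_coarea b c (h L A B : R) (V : R * R -> R) :
  (0 < h)%R -> (0 <= L)%R -> (0 <= A)%R -> (0 <= B)%R ->
  (forall y z, square c h y -> square c h z -> V y = V z ->
    (enorm (y - z) <= L * `|coor b y - coor b z|)%R) ->
  (forall y z, square c h y -> square c h z -> (`|V y - V z| <=
    A * `|coor b y - coor b z| + B * `|coor (~~ b) y - coor (~~ b) z|)%R) ->
  exists J : measurableTypeR R -> \bar R,
    [/\ measurable_fun setT J, forall t, 0 <= J t,
      \int[lebesgue_measure]_t J t <= (L * B * h ^+ 2)%:E &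
      forall t E, E `<=` square c h -> (forall y, E y -> V y = t) ->
        hausdorff1 E <= J t].
Proof.
move=> h0 L0 A0 B0 HL HAB.
have /choice[S HS] N := level_set_strip_bound h0 L0 A0 B0 (ltn0Sn N) HL HAB.
exists (fun t => limn_einf (fun N => (S N t)%:E)); split.
- apply: measurable_limn_einf => N; apply/measurable_EFinP.
  by have [] := HS N.
- move=> t; apply: limn_einf_ge; apply: nearW => N; rewrite lee_fin.
  by have [] := HS N.
- apply: le_trans (fatou _ _ _ _) _ => //.
  + by move=> N; apply/measurable_EFinP; have [] := HS N.
  + by move=> N t _; rewrite lee_fin; have [] := HS N.
  rewrite (_ : (fun n => _) = (fun N => (L * B * h ^+ 2 + (A * L * h ^+ 2) * N.+1%:R^-1)%:E)).
    have : (L * B * h ^+ 2 + (A * L * h ^+ 2) * N.+1%:R^-1)%:E @[N --> \oo] -->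
        (L * B * h ^+ 2 + (A * L * h ^+ 2) * 0)%:E.
      apply: cvg_EFin; first exact: nearW.
      apply: cvgD; first exact: cvg_cst.
      by apply: cvgM; [exact: cvg_cst|exact: cvg_harmonic].
    by move=> /cvg_limn_einf_sup[-> _]; rewrite mulr0 addr0.
  by apply/funext => N; have [] := HS N.
move=> t E EQ EV; apply: ge_ereal_sup => _ [delta /= delta0 <-].
apply: limn_einf_ge.
have := near_scaled_harmonic_lt (L * h) delta0; apply: filterS => N HN.
by have [_ _ _] := HS N; apply => //; rewrite mulrA ltW.
Qed.

End hausdorff_bounds.

(** * Integration against the restriction of an outer measure *)

Import HBNNSimple.

Section caratheodory_integral.
Local Open Scope ereal_scope.
Context {R : realType} {T : pointedType} (mu : {outer_measure set T -> \bar R}).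
Implicit Types A X : set T.

(** Caratheodory's criterion tests measurable sets against every set [X], so the
    outer measure is additive on the traces of the level sets on [X] even when
    [X] is not measurable. *)
Lemma caratheodory_level_sum (h : T -> R) X (s : seq R) : uniq s ->
  (forall c, mu.-caratheodory (h @^-1` [set c])) ->
  \sum_(c <- s) mu (X `&` h @^-1` [set c]) <= mu X.
Proof.
move=> us mh; suff : \sum_(c <- s) mu (X `&` h @^-1` [set c]) <=
    mu (X `&` h @^-1` [set` s]).
  by move=> /le_trans; apply; apply: le_outer_measure => x [].
elim: s us => [|c s IH] /=; first by rewrite big_nil outer_measure_ge0.
move=> /andP[cs /IH{}IH]; rewrite big_cons (mh c (_ `&` h @^-1` [set` _])).
apply: leeD.
  apply: le_outer_measure => x [Xx /= hx]; do 2 split => //=.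
  by rewrite hx mem_head.
apply: le_trans IH _; apply: le_outer_measure => x [Xx /= hx]; split.
  by split => //=; rewrite in_cons hx orbT.
by move=> hc; move: cs; rewrite -hc hx.
Qed.

(** The integral is a supremum over simple functions h below [w], and
    [caratheodory_level_sum] applies to the level sets of h inside each piece
    [E i]. This bounds integrals over level sets of a function against Hausdorff
    measure without proving that Borel sets are measurable for it. *)
Lemma caratheodory_integral_le (n : nat) (D : set T) (E : nat -> set T)
    (W : nat -> R) (w : T -> R) :
  D `<=` \bigcup_(i < n) E i -> (forall x, 0 <= w x)%R ->
  (forall i, 0 <= W i)%R -> (forall i x, (i < n)%N -> E i x -> w x <= W i)%R ->
  \int[caratheodory_measure mu]_(x in D) (w x)%:E <= \sum_(i < n) (W i)%:E * mu (E i).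
Proof.
move=> DE w0 W0 wW; rewrite ge0_integralE; last by move=> x _; rewrite lee_fin.
apply: ge_ereal_sup => _ [h /= hw <-].
pose g : T -> R := (h : caratheodory_type mu -> R).
have mh c : mu.-caratheodory (g @^-1` [set c]).
  exact: (measurable_sfunP h (measurable_set1 c)).
rewrite sintegralE (@fsbig_finite _ _ _ _ (range h))/=; last exact: fimfunP.
set s : seq R := finmap.enum_fset _.
have H : \sum_(c <- s) c%:E * mu (g @^-1` [set c]) <=
    \sum_(c <- s) \sum_(i < n) (W i)%:E * mu (E i `&` g @^-1` [set c]).
  rewrite big_seq [leRHS]big_seq; apply: lee_sum => c.
  rewrite /s in_fset_set ?inE; last exact: fimfunP.
  move=> -[x _ xc].
  have c0 : (0 <= c)%R by rewrite -xc.
  move: c0; rewrite le_eqVlt => /predU1P[<-|c0].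
    by rewrite mul0e; apply: sume_ge0 => i _; rewrite mule_ge0 ?lee_fin.
  have hcD : g @^-1` [set c] `<=` D.
    move=> y hy; apply: contrapT => nDy; have := hw y.
    by rewrite patchN ?notin_setE// (hy : h y = c) lee_fin leNgt c0.
  apply: (@le_trans _ _ (c%:E * \sum_(i < n) mu (E i `&` g @^-1` [set c]))).
    apply: lee_wpmul2l; first by rewrite lee_fin ltW.
    apply: le_trans (outer_measure_subadditive mu (fun i => E i `&` g @^-1` [set c]) n).
    apply: le_outer_measure => y hy; have [i /= ni Eiy] := DE _ (hcD _ hy).
    by rewrite -(bigcup_mkord n (fun i => E i `&` g @^-1` [set c])); exists i.
  rewrite ge0_sume_distrr; last by move=> i _; exact: outer_measure_ge0.
  apply: lee_sum => i _.
  have [->|/set0P[y [Ey hy]]] := eqVneq (E i `&` g @^-1` [set c]) set0.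
    by rewrite outer_measure0 !mule0.
  apply: lee_wpmul2r; first exact: outer_measure_ge0.
  rewrite lee_fin; apply: le_trans (wW _ _ (ltn_ord i) Ey).
  have := hw y; rewrite patchT ?mem_set//; last exact: hcD.
  by rewrite (hy : h y = c) lee_fin.
apply: le_trans H _.
rewrite exchange_big/=; apply: lee_sum => i _.
rewrite -ge0_sume_distrr; last by move=> c _; exact: outer_measure_ge0.
apply: lee_wpmul2l; first by rewrite lee_fin.
by apply: caratheodory_level_sum => //; exact: finmap.fset_uniq.
Qed.

End caratheodory_integral.

(** * Lebesgue measure of the plane *)

Section plane_measure.
Context {R : realType}.
Let Plane := (measurableTypeR R * measurableTypeR R)%type.

(** An open set is a countable union of boxes with rational corners. *)
Lemma open_measurable_plane (U : set (R * R)) : open U ->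
  measurable (U : set Plane).
Proof.
move=> oU.
pose box (k : rat * rat * (rat * rat)) : set Plane :=
  `]ratr k.1.1, ratr k.1.2[%classic `*` `]ratr k.2.1, ratr k.2.2[%classic.
pose F k := if pselect (box k `<=` U) then box k else set0.
have -> : U = \bigcup_k F k.
  apply/seteqP; split => [x Ux|x [k _]]; last first.
    by rewrite /F; case: pselect => // kU /kU.
  have /nbhs_ballP[e /= e0 He] : nbhs x U by exact: open_nbhs_nbhs.
  have [a] := @rat_in_itvoo R (x.1 - e) x.1 ltac:(by rewrite ltrBlDr ltrDl).
  have [b] := @rat_in_itvoo R x.1 (x.1 + e) ltac:(by rewrite ltrDl).
  have [c] := @rat_in_itvoo R (x.2 - e) x.2 ltac:(by rewrite ltrBlDr ltrDl).
  have [d] := @rat_in_itvoo R x.2 (x.2 + e) ltac:(by rewrite ltrDl).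
  rewrite !in_itv /= => hd hc hb ha.
  exists ((a, b), (c, d)) => //; rewrite /F; case: pselect => /= [bU|].
    by split; rewrite /= in_itv /=; lra.
  case=> y [/= + +]; rewrite !in_itv /= => /andP[y1 y1'] /andP[y2 y2'].
  apply: He; apply/ball_prodE; rewrite !ltr_norml; split; apply/andP; split; lra.
apply: countable_bigcupT_measurable; first exact: countableP.
move=> k; rewrite /F; case: pselect => //= bU.
by apply: measurableX; exact: measurable_itv.
Qed.

Lemma continuous_measurable_plane (f : R * R -> R) : continuous f ->
  measurable_fun [set: Plane] (f : Plane -> measurableTypeR R).
Proof.
move=> /continuousP cf; apply: (measurability _ (RGenOpens.measurableE R)).
move=> _ [_ [a [b ->] <-]]; rewrite setTI; apply: open_measurable_plane.
exact/cf/interval_open.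
Qed.

Lemma measurable_square (c : R * R) (h : R) : measurable (square c h : set Plane).
Proof.
rewrite (_ : square c h = `[c.1, (c.1 + h)%R[%classic `*` `[c.2, (c.2 + h)%R[%classic).
  by apply: measurableX; exact: measurable_itv.
apply/seteqP; split => x /=; rewrite !in_itv /=.
  by move=> h'; split; [exact: (h' true)|exact: (h' false)].
by move=> [? ?] [].
Qed.

Lemma lebesgue2_square (c : R * R) (h : R) : 0 < h ->
  lebesgue2 (square c h : set Plane) = (h ^+ 2)%:E.
Proof.
move=> h0.
rewrite (_ : square c h = `[c.1, (c.1 + h)%R[%classic `*` `[c.2, (c.2 + h)%R[%classic); last first.
  apply/seteqP; split => x /=; rewrite !in_itv /=.
    by move=> h'; split; [exact: (h' true)|exact: (h' false)].
  by move=> [? ?] [].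
apply: (etrans (@product_measure1E _ _ _ _ R lebesgue_measure lebesgue_measure
  `[c.1, (c.1 + h)%R[%classic `[c.2, (c.2 + h)%R[%classic
  (measurable_itv _) (measurable_itv _))).
rewrite /= !lebesgue_measure_itv /= !lte_fin !ltrDl h0 -!EFinB -EFinM.
by congr (_%:E); ring.
Qed.

Lemma sigma_finite_lebesgue2 : sigma_finite [set: Plane] lebesgue2.
Proof.
exists (fun n => square (- n.+1%:R, - n.+1%:R) (2 * n.+1%:R) : set Plane).
  by apply/seteqP; split => // x _; have [n xn] := square_exhaust x; exists n.
move=> n; split; first exact: measurable_square.
by rewrite (lebesgue2_square _ (mulr_gt0 _ _)) ?ltry.
Qed.

Lemma continuous_powR_at (a p : R) : 0 < a -> {for a, continuous (fun t => t `^ p)}.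
Proof.
move=> a0.
apply: (@cvg_trans _ (expR (p * ln t) @[t --> a])).
  apply: near_eq_cvg; near=> t.
  have t0 : 0 < t by near: t; apply: (cvgr_gt a) => //; exact: cvg_id.
  by rewrite /powR gt_eqF.
rewrite /powR gt_eqF//; apply: (continuous_comp (f := fun t => p * ln t) (g := expR)).
  by apply: cvgM; [exact: cvg_cst|exact: continuous_ln].
exact: continuous_expR.
Unshelve. all: by end_near. Qed.

Lemma continuous_weight (p : R) (x : R * R) : x != 0 ->
  {for x, continuous (fun y => enorm y `^ p)}.
Proof.
move=> x0; apply: (@continuous_comp _ _ _ enorm (fun t : R => t `^ p)).
  exact: continuous_enorm.
by apply: continuous_powR_at; rewrite enorm_gt0.
Qed.

Lemma measurable_weight (p : R) :
  measurable_fun [set: Plane] ((fun y => enorm y `^ p) : Plane -> measurableTypeR R).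
Proof.
apply: (measurableT_comp (f := fun t : measurableTypeR R => t `^ p : measurableTypeR R)).
  exact: measurable_powR.
exact: (continuous_measurable_plane continuous_enorm).
Qed.

End plane_measure.

(** * The coarea inequality *)

Section coarea.
Context {R : realType}.
Let Plane := (measurableTypeR R * measurableTypeR R)%type.
Variables (u w : R * R -> R) (eps : R).
Hypotheses (u1 : Ck 1 u) (eps0 : 0 < eps).
Hypotheses (w0 : forall x, 0 <= w x)
  (mw : measurable_fun [set: Plane] (w : Plane -> measurableTypeR R)).

Let dens x := w x * enorm (grad u x).

Let dens0 x : 0 <= dens x.
Proof. by rewrite mulr_ge0// enorm_ge0. Qed.

Lemma measurable_density :
  measurable_fun [set: Plane] (fun x => (w x * enorm (grad u x))%:E).
Proof.
apply/measurable_EFinP; apply: measurable_funM; first exact: mw.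
by apply: continuous_measurable_plane; exact: continuous_grad_norm.
Qed.

Local Open Scope ereal_scope.

(** The coarea inequality with relative error [eps] on a square, in the form
    that survives sums over squares: [W] bounds the weight, and [J] is a
    measurable bound of the weighted length of the level t in the square. *)
Definition coarea_square (c : R * R) (h : R) : Prop :=
  exists (J : measurableTypeR R -> \bar R) (W : R),
  [/\ measurable_fun setT J, forall t, 0 <= J t, (0 <= W)%R &
    [/\ \int[lebesgue_measure]_t J t <= (1 + eps)%:E *
        \int[lebesgue2]_(x in square c h) (w x * enorm (grad u x))%:E,
      forall y, square c h y -> (w y <= W)%R &
      forall t E, (0 < t)%R -> E `<=` square c h -> (forall y, E y -> `|u y|%R = t) ->
        W%:E * hausdorff1 E <= J t]].

Lemma near_ball_sub (x : R * R) (P : R * R -> Prop) : (\forall y \near x, P y) ->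
  \forall e \near (0 : R)^'+, forall y, ball x e y -> P y.
Proof.
move=> /nbhs_ballP[e /= e0 He]; near=> d => y dy; apply: He.
by apply: le_ball dy; near: d; exact: nbhs_right_le.
Unshelve. all: by end_near. Qed.

(** On a small square around [x] the weight, the gradient and the slope of the
    level sets are nearly constant. The number u(x) is nonzero so that the levels
    of |u| on the square are levels of u. *)
Lemma near_coarea_square (x : R * R) : (0 < w x)%R -> {for x, continuous w} ->
  u x != 0%R -> grad u x != 0%R ->
  \forall e \near (0 : R)^'+, forall c h, (0 < h)%R -> square c h `<=` ball x e ->
    coarea_square c h.
Proof.
move=> wx0 cw ux0 gx0.
have [b bx0] : exists b, partial (~~ b) u x != 0%R.
  apply: contrapT => /forallNP h; move/eqP: gx0; apply.
  have p0 b : partial (~~ b) u x = 0%R by apply/eqP/negPn/negP/h.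
  have p1 : partial1 u x = 0%R := p0 false.
  have p2 : partial2 u x = 0%R := p0 true.
  by rewrite /grad p1 p2.
(* Four factors k are lost: on w, on the slope, on the transverse partial
   derivative and on the density. *)
pose k := Num.sqrt (Num.sqrt (1 + eps)).
have k4 : (k ^+ 4 = 1 + eps)%R.
  by rewrite (exprM k 2 2) !sqr_sqrtr ?sqrtr_ge0// addr_ge0// ltW.
have k1 : (1 < k)%R.
  rewrite ltNge; apply/negP => k1.
  have : (k ^+ 4 <= 1)%R by rewrite exprn_ile1// sqrtr_ge0.
  by rewrite k4 leNgt ltrDl eps0.
have k0 : (0 < k)%R by apply: lt_trans k1.
set D := enorm (grad u x); set P := `|partial (~~ b) u x|%R.
have D0 : (0 < D)%R by rewrite enorm_gt0.
have P0 : (0 < P)%R by rewrite normr_gt0.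
pose A := (`|partial b u x| + 1)%R.
have hL : (D < (k * D / P) * P)%R by rewrite divfK ?gt_eqF// ltr_pMl.
have hA : (`|partial b u x| < A)%R by rewrite ltrDl.
have hB : (P < k * P)%R by rewrite ltr_pMl.
have N1 := level_set_graph u1 hL.
have N2 := lipschitz_near u1 hA hB.
have cd : dens y @[y --> x] --> dens x.
  by apply: cvgM; [exact: cw|exact: (continuous_grad_norm u1)].
have N3 : \forall y \near x, (w y < k * w x)%R.
  by apply: (cvgr_lt _ cw); rewrite ltr_pMl.
have N4 : \forall y \near x, (k^-1 * (w x * D) < dens y)%R.
  by apply: (cvgr_gt _ cd); rewrite gtr_pMl ?mulr_gt0// invf_lt1.
have N5 : \forall y \near x, (0 < u y * u x)%R.
  have cu : (u y * u x)%R @[y --> x] --> (u x * u x)%R.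
    by apply: cvgM; [exact: (continuous_of_Ck u1)|exact: cvg_cst].
  by apply: (cvgr_gt _ cu); rewrite -expr2 exprn_even_gt0.
have {}N3 := near_ball_sub N3; have {}N4 := near_ball_sub N4.
have {}N5 := near_ball_sub N5.
near=> e => c h h0 Qe.
have Le0 : (0 <= k * D / P)%R by rewrite divr_ge0// ?mulr_ge0// ltW.
have A0 : (0 <= A)%R by rewrite addr_ge0.
have B0 : (0 <= k * P)%R by rewrite mulr_ge0// ltW.
have u_eq y z : square c h y -> square c h z -> `|u y|%R = `|u z|%R -> u y = u z.
  move=> /Qe ey /Qe ez.
  have : (0 < u y * u x)%R by move: y ey; near: e.
  have : (0 < u z * u x)%R by move: z ez; near: e.
  move=> zx yx /eqP; rewrite eqr_norm2 => /orP[/eqP//|/eqP yz].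
  by move: zx yx; rewrite yz mulNr => zx; rewrite oppr_gt0 ltNge (ltW zx).
have [||J [mJ J0 intJ HJ]] := @square_coarea R b c h _ A _ (fun y => `|u y|%R) h0 Le0 A0 B0.
- move=> y z yQ zQ yz.
  have H : forall y z, ball x e y -> ball x e z -> u y = u z ->
    (enorm (y - z) <= k * D / P * `|coor b y - coor b z|)%R by near: e.
  by apply: H; [exact: Qe|exact: Qe|exact: u_eq].
- move=> y z yQ zQ; apply: le_trans (ler_dist_dist _ _) _.
  have H : forall y z, ball x e y -> ball x e z ->
    (`|u y - u z| <= A * `|coor b y - coor b z| + k * P * `|coor (~~ b) y - coor (~~ b) z|)%R.
    by near: e.
  by apply: H; exact: Qe.
have W0 : (0 <= k * w x)%R by rewrite mulr_ge0// ltW.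
exists (fun t => (k * w x)%:E * J t), (k * w x)%R; split => //.
- exact: measurable_funeM.
- by move=> t; rewrite mule_ge0.
split.
- rewrite ge0_integralZl_EFin//.
  apply: (@le_trans _ _ ((1 + eps)%:E * (k^-1 * (w x * D) * h ^+ 2)%:E)).
    apply: le_trans (lee_wpmul2l _ intJ) _; first by rewrite lee_fin.
    rewrite -!EFinM lee_fin -k4 le_eqVlt; apply/orP; left; apply/eqP.
    by field; rewrite !gt_eqF.
  apply: lee_wpmul2l; first by rewrite lee_fin addr_ge0// ltW.
  rewrite EFinM -(lebesgue2_square c h0) -integral_cst; last exact: measurable_square.
  apply: ge0_le_integral.
  + exact: measurable_square.
  + by move=> y _; rewrite lee_fin mulr_ge0 ?mulr_ge0 ?invr_ge0// ltW.
  + exact: measurable_cst.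
  + by apply: measurable_funTS; exact: measurable_density.
  + move=> y /Qe ey; rewrite lee_fin ltW//.
    by move: y ey; near: e.
- by move=> y /Qe ey; apply: ltW; move: y ey; near: e.
- move=> t E t0 EQ Et; apply: lee_wpmul2l; first by rewrite lee_fin.
  exact: HJ.
Unshelve. all: by end_near. Qed.

End coarea.

Section grid.
Context {R : realType}.
Implicit Types (M : R) (n k : nat).

(** The squares are numbered row by row, square i * n + j being the j-th of the
    i-th row. *)
Definition grid_corner M n k : R * R :=
  (- M + (k %/ n)%:R * (2 * M / n%:R), - M + (k %% n)%:R * (2 * M / n%:R)).

Definition grid_square M n k := square (grid_corner M n k) (2 * M / n%:R).

Lemma grid_cover M n x : 0 < M -> (0 < n)%N -> square (- M, - M) (2 * M) x ->
  exists2 k, (k < n * n)%N & grid_square M n k x.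
Proof.
move=> M0 n0 xQ; have M20 : 0 < 2 * M by rewrite mulr_gt0.
have [i Hi] := exists_cell M20 n0 (xQ true).
have [j Hj] := exists_cell M20 n0 (xQ false).
exists (i * n + j)%N.
  by apply: (@leq_trans (i * n + n)); rewrite ?ltn_add2l// -mulSnr leq_mul2r ltn_ord orbT.
rewrite /grid_square /grid_corner divnMDl// modnMDl divn_small// addn0 modn_small//.
by case.
Qed.

Lemma cell_inj (a h x : R) (i j : nat) : a + i%:R * h <= x < a + i%:R * h + h ->
  a + j%:R * h <= x < a + j%:R * h + h -> i = j.
Proof.
move=> /andP[i1 i2] /andP[j1 j2].
have h0 : 0 < h by rewrite -(ltrDl (a + i%:R * h)); exact: le_lt_trans i2.
have K (k l : nat) : a + k%:R * h <= x -> x < a + l%:R * h + h -> (k <= l)%N.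
  move=> kx xl; rewrite -ltnS -(ltr_nat R) -(ltr_pM2r h0) -natr1 mulrDl mul1r.
  by rewrite -(ltrD2l a) addrA; exact: le_lt_trans xl.
by apply/eqP; rewrite eqn_leq (K i j)//= (K j i).
Qed.

Lemma grid_trivIset M n (D : set nat) : trivIset D (grid_square M n).
Proof.
move=> k l _ _ [x [xk xl]].
have q := cell_inj (xk true) (xl true); have r := cell_inj (xk false) (xl false).
by rewrite (divn_eq k n) (divn_eq l n) q r.
Qed.

Lemma square_ball (c x y : R * R) (h : R) : square c h x -> square c h y -> ball x h y.
Proof.
move=> xQ yQ; apply/ball_coord => b; rewrite ltr_norml.
by have := xQ b; have := yQ b; lra.
Qed.

End grid.

Section coarea_inequality.
Context {R : realType}.
Let Plane := (measurableTypeR R * measurableTypeR R)%type.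
Variables (u w : R * R -> R) (eps : R).
Hypotheses (u1 : Ck 1 u) (usupp : compactly_supported u) (eps0 : 0 < eps).
Hypotheses (w0 : forall x, 0 <= w x)
  (mw : measurable_fun [set: Plane] (w : Plane -> measurableTypeR R)).
Local Open Scope ereal_scope.

Let dens x := (w x * enorm (grad u x))%:E.

Let dens0 x : 0 <= dens x.
Proof. by rewrite lee_fin mulr_ge0// enorm_ge0. Qed.

(** The bound [J] adds up those of the squares to which [coarea_square] applies,
    and the other squares contribute 0; hence only the levels that avoid the
    latter are controlled. *)
Lemma grid_coarea (M : R) (n : nat) : (0 < M)%R -> (0 < n)%N ->
  exists J : measurableTypeR R -> \bar R,
  [/\ measurable_fun setT J, forall t, 0 <= J t,
    \int[lebesgue_measure]_t J t <= (1 + eps)%:E * \int[lebesgue2]_x dens x &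
    forall t D, (0 < t)%R -> (forall x, D x -> `|u x|%R = t) ->
      D `<=` square (- M, - M)%R (2 * M)%R ->
      (forall k, D `&` grid_square M n k !=set0 ->
        coarea_square u w eps (grid_corner M n k) (2 * M / n%:R)%R) ->
      \int[hausdorff1_measure]_(x in D) (w x)%:E <= J t].
Proof.
move=> M0 n0.
have e1 : 0 <= (1 + eps)%:E by rewrite lee_fin addr_ge0// ltW.
pose Q := grid_square M n.
have mQ k : measurable (Q k : set Plane) by exact: measurable_square.
have mdens A : measurable_fun (A : set Plane) dens.
  by apply: measurable_funTS; exact: measurable_density.
have /choice[J /choice[W HJ]] k : exists (J : measurableTypeR R -> \bar R) (W : R),
  [/\ measurable_fun setT J, forall t, 0 <= J t, (0 <= W)%R,
    \int[lebesgue_measure]_t J t <= (1 + eps)%:E * \int[lebesgue2]_(x in Q k) dens x &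
    coarea_square u w eps (grid_corner M n k) (2 * M / n%:R)%R ->
    (forall y, Q k y -> (w y <= W)%R) /\
      forall t E, (0 < t)%R -> E `<=` Q k -> (forall y, E y -> `|u y|%R = t) ->
        W%:E * hausdorff1 E <= J t].
  have [[J [W [mJ J0 W0 [iJ wW HJ]]]]|ngood] :=
      pselect (coarea_square u w eps (grid_corner M n k) (2 * M / n%:R)%R).
    by exists J, W; split.
  exists (cst 0), 0%R; split => //.
  by rewrite integral0; apply: mule_ge0 => //; apply: integral_ge0.
exists (fun t => \sum_(k <- iota 0 (n * n)) J k t); split.
- by apply: emeasurable_sum => k; have [] := HJ k.
- by move=> t; apply: sume_ge0 => k _; have [] := HJ k.
- rewrite ge0_integral_sum//; last 2 first.
  + by move=> k; have [] := HJ k.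
  + by move=> k t _; have [] := HJ k.
  apply: (@le_trans _ _ (\sum_(k <- iota 0 (n * n))
      (1 + eps)%:E * \int[lebesgue2]_(x in Q k) dens x)).
    by apply: lee_sum => k _; have [] := HJ k.
  rewrite -ge0_sume_distrr; last by move=> k _; apply: integral_ge0.
  apply: lee_wpmul2l => //.
  rewrite -ge0_integral_bigsetU//; last 2 first.
  + exact: iota_uniq.
  + exact: grid_trivIset.
  apply: ge0_subset_integral => //.
  by apply: bigsetU_measurable => k _; exact: mQ.
move=> t D t0 Dt DM Dgood.
pose E k := D `&` Q k.
apply: (@le_trans _ _ (\sum_(k < n * n) (W k)%:E * hausdorff1 (E k))).
  apply: (@caratheodory_integral_le R _ (@hausdorff1 R)) => //.
  - move=> x Dx; have [k kn xk] := grid_cover M0 n0 (DM _ Dx).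
    by exists k.
  - by move=> k; have [] := HJ k.
  - move=> k x _ [Dx Qx]; have [_ _ _ _] := HJ k; case => [|+ _]; last exact.
    by apply: Dgood; exists x.
rewrite -(big_mkord xpredT (fun k => (W k)%:E * hausdorff1 (E k))) /index_iota subn0.
apply: lee_sum => k _.
have [E0|/set0P E0] := eqVneq (E k) set0.
  by rewrite E0 hausdorff1_set0 mule0; have [] := HJ k.
have [_ _ _ _] := HJ k; case => [|_]; first exact: Dgood.
by apply => // [x []//|x [/Dt]].
Qed.

Lemma supp_square : exists2 M : R, (0 < M)%R &
  forall x, u x != 0%R -> square (- M, - M)%R (2 * M)%R x.
Proof.
have /compact_bounded[M [_ HM]] := usupp.
have M1 : (M < `|M| + 1)%R by rewrite (le_lt_trans (ler_norm M))// ltrDl.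
have M2 : (0 < `|M| + 1)%R by rewrite ltr_wpDl.
exists (`|M| + 1 + 1)%R; first by rewrite addr_gt0.
move=> x ux; have := HM _ M1 x (@subset_closure _ [set x | u x != 0%R] x ux).
rewrite /= prod_normE/= ge_max => /andP[x1 x2].
by move: x1 x2; rewrite !ler_norml => ? ?; case => /=; lra.
Qed.

Lemma compact_level (t : R) : (0 < t)%R -> compact [set x | `|u x|%R = t].
Proof.
move=> t0; apply: subclosed_compact usupp _.
  rewrite (_ : [set _ | _] = (fun x => `|u x|%R) @^-1` [set y | y = t])//.
  apply: preimage_closed => //.
  by move=> x _; apply: cvg_norm; exact: (continuous_of_Ck u1).
by move=> x /= ut; apply: subset_closure => /=; rewrite -normr_gt0 ut.
Qed.

(** Near a level set on which the gradient and the weight do not vanish, all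
    small enough squares satisfy [coarea_square], hence by compactness so do all
    the squares of a fine enough grid that meet the level set. Fatou's lemma lets
    the grid depend on the level. *)
Lemma coarea_inequality : exists J : measurableTypeR R -> \bar R,
  [/\ measurable_fun setT J, forall t, 0 <= J t,
    \int[lebesgue_measure]_t J t <= (1 + eps)%:E * \int[lebesgue2]_x dens x &
    forall t D, (0 < t)%R -> (forall x, D x -> `|u x|%R = t) ->
      (forall x, `|u x|%R = t ->
        [/\ grad u x != 0%R, (0 < w x)%R & {for x, continuous w}]) ->
      \int[hausdorff1_measure]_(x in D) (w x)%:E <= J t].
Proof.
have [M M0 HM] := supp_square.
have /choice[J HJ] n := grid_coarea M0 (ltn0Sn n).
exists (fun t => limn_einf (fun n => J n t)); split.
- by apply: measurable_limn_einf => n; have [] := HJ n.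
- by move=> t; apply: limn_einf_ge; apply: nearW => n; have [] := HJ n.
- apply: le_trans (fatou _ _ _ _) _ => //.
  + by move=> n; have [] := HJ n.
  + by move=> n t _; have [] := HJ n.
  by apply: limn_einf_le => n; have [] := HJ n.
move=> t D t0 Dt Hreg; apply: limn_einf_ge.
have uN0 x : `|u x|%R = t -> u x != 0%R by rewrite -normr_gt0 => ->.
have : \forall n \near \oo, [set x | `|u x|%R = t] `<=`
    (fun x => forall c, square c (2 * M / n.+1%:R) x ->
       coarea_square u w eps c (2 * M / n.+1%:R)).
  apply: (proj1 (compact_near_coveringP _) (compact_level t0)) => x /= xt.
  have [gx wx cwx] := Hreg _ xt.
  have := near_coarea_square u1 eps0 w0 mw wx cwx (uN0 _ xt) gx.
  move=> H; have [e [e0 He]] := filter_ex (filterI (nbhs_right_gt 0%R) H).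
  have e20 : (0 < e / 2)%R by rewrite divr_gt0.
  exists (ball x (e / 2)%R, [set n | (2 * M * n.+1%:R^-1 < e / 2)%R]).
    by split; [exact: nbhsx_ballx|exact: near_scaled_harmonic_lt].
  move=> [y n] [/= yx hn] c cy.
  have h0 : (0 < 2 * M / n.+1%:R)%R by rewrite divr_gt0 ?mulr_gt0.
  apply: He => // z cz; rewrite (splitr e); apply: ball_triangle yx _.
  by apply: le_ball (square_ball cy cz); exact: ltW.
apply: filterS => n Hn; have [_ _ _] := HJ n; apply => //.
  by move=> x /Dt/uN0; exact: HM.
by move=> k [x [/Dt xt xk]]; apply: (Hn x).
Qed.

End coarea_inequality.

(** * Sard's theorem *)

Section sard.
Context {R : realType}.
Notation lambda := (@lebesgue_measure R).

(** Each piece of the cover has its image in an interval of length 2 d. *)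
Lemma negligible_image (T : Type) (phi : T -> R) (E : set T) :
  (forall eta : R, 0 < eta -> exists (n : nat) (F : nat -> set T) (d : R),
    [/\ 0 <= d, n%:R * (2 * d) <= eta, E `<=` \bigcup_(i < n) F i &
      forall i x y, F i x -> F i y -> E x -> E y -> `|phi x - phi y| <= d]) ->
  lambda.-negligible (phi @` E).
Proof.
move=> H.
have small (eta : R) : 0 < eta -> exists B : set (measurableTypeR R),
    [/\ measurable B, phi @` E `<=` B & (lambda B <= eta%:E)%E].
  move=> /H[n [F [d [d0 nd EF Fd]]]].
  have /choice[I HI] i : exists I : set (measurableTypeR R), [/\ measurable I,
      (lambda I <= (2 * d)%:E)%E & forall x, E x -> F i x -> I (phi x)].
    have [E0|/set0P[y [Ey Fy]]] := eqVneq (E `&` F i) set0.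
      exists set0; split; rewrite ?measure0 ?lee_fin ?mulr_ge0// => x Ex Fx.
      by have : (E `&` F i) x by []; rewrite E0.
    exists `[phi y - d, phi y + d]%classic; split; first exact: measurable_itv.
      rewrite /= lebesgue_measure_itv /= lte_fin; case: ifPn => _.
        by rewrite -EFinB lee_fin; lra.
      by rewrite lee_fin mulr_ge0.
    by move=> x Ex Fx; rewrite /= in_itv /= -ler_distl; exact: (Fd _ _ _ Fx Fy Ex Ey).
  exists (\big[setU/set0]_(i < n) I i); split.
    by apply: bigsetU_measurable => i _; have [] := HI i.
    move=> _ [x Ex <-]; rewrite -bigcup_mkord; have [i ni Fx] := EF _ Ex.
    by exists i => //; have [_ _] := HI i; apply.
  apply: (@le_trans _ _ (\sum_(i < n) lambda (I i))%E).
    by apply: Boole_inequality => i; have [] := HI i.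
  apply: (@le_trans _ _ (\sum_(i < n) (2 * d)%:E)%E).
    by apply: lee_sum => i _; have [] := HI i.
  by rewrite sumEFin sumr_const card_ord lee_fin -[leLHS]mulr_natl.
have /choice[B HB] (n : nat) := small n.+1%:R^-1 ltac:(by rewrite invr_gt0).
exists (\bigcap_n B n); split.
- by apply: bigcapT_measurable => n; have [] := HB n.
- apply/eqP; rewrite eq_le measure_ge0 andbT; apply/lee_addgt0Pr => e e0.
  rewrite add0e; have := @cvg_harmonic R => /cvgr_lt /(_ _ e0)[N _ /(_ N (leqnn _)) /= Ne].
  have [mB _ BN] := HB N.
  apply: (@le_trans _ _ (lambda (B N))).
    apply: le_measure; rewrite ?inE//; last exact: bigcap_inf.
    by apply: bigcapT_measurable => n; have [] := HB n.
  by apply: (le_trans BN); rewrite lee_fin ltW.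
- by move=> y Ey n _; have [_ + _] := HB n; apply.
Qed.

Variable (u : R * R -> R).
Hypothesis u2 : Ck 2 u.

Let crit := [set x | grad u x = 0].

Let Du_0 b x : crit x -> partial b u x = 0.
Proof. by case: b => -[]. Qed.

Lemma near_second_derivative (x : R * R) (M : R) :
  (forall b b', `|partial b (partial b' u) x| < M) ->
  \forall e \near (0 : R)^'+, forall y, ball x e y ->
    forall b b', `|partial b (partial b' u) y| <= M.
Proof.
move=> hM.
have K b b' : \forall y \near x, `|partial b (partial b' u) y| <= M.
  have c : partial b (partial b' u) y @[y --> x] --> partial b (partial b' u) x.
    exact: (Ck1_continuous (Ck_partial b' u2)).
  exact: (cvgr_norm_le _ c _ (hM b b')).
have K' b b' := near_ball_sub (K b b').
have H1 : \forall e \near (0 : R)^'+, (forall y, ball x e y -> `|partial true (partial true u) y| <= M) /\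
    (forall y, ball x e y -> `|partial true (partial false u) y| <= M).
  by apply: filterI; exact: K'.
have H2 : \forall e \near (0 : R)^'+, (forall y, ball x e y -> `|partial false (partial true u) y| <= M) /\
    (forall y, ball x e y -> `|partial false (partial false u) y| <= M).
  by apply: filterI; exact: K'.
have [d1 /= d10 Hd1] := H1; have [d2 /= d20 Hd2] := H2.
exists (Num.min d1 d2); first by rewrite /= lt_min d10.
move=> e /=; rewrite lt_min => /andP[e1 e2] e0 y ye b b'.
have [h1 h2] := Hd1 _ e1 e0; have [h3 h4] := Hd2 _ e2 e0.
case: b; case: b'; [exact: h1|exact: h2|exact: h3|exact: h4].
Qed.

(** Where some second derivative D_b D_b' u is nonzero, the critical set lies in
    a level set of D_b' u, which is a Lipschitz graph, and the increments of u
    on it are quadratic in the coordinate of the graph. *)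
Lemma sard_curve (b b' : bool) (x : R * R) : partial b (partial b' u) x != 0 ->
  \forall e \near (0 : R)^'+, lambda.-negligible (u @` (crit `&` ball x e)).
Proof.
move=> x0.
pose g := partial b' u; have g1 : Ck 1 g := Ck_partial b' u2.
have gx0 : 0 < `|partial (~~ ~~ b) g x| by rewrite negbK normr_gt0.
pose c := enorm (grad g x) / `|partial (~~ ~~ b) g x| + 1.
have hc : enorm (grad g x) < c * `|partial (~~ ~~ b) g x|.
  by rewrite mulrDl divfK ?gt_eqF// mul1r ltrDl.
have c0 : 0 <= c by rewrite addr_ge0// divr_ge0 ?enorm_ge0.
pose s b1 b2 := `|partial b1 (partial b2 u) x|.
pose M := s true true + s true false + s false true + s false false + 1.
have s0 b1 b2 : 0 <= s b1 b2 by exact: normr_ge0.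
have M0 : 0 <= M by rewrite !addr_ge0.
have hM b1 b2 : s b1 b2 < M.
  have lt4 (x1 x2 x3 x4 : R) : 0 <= x1 -> 0 <= x2 -> 0 <= x3 -> 0 <= x4 ->
      let S := x1 + x2 + x3 + x4 + 1 in [/\ x1 < S, x2 < S, x3 < S & x4 < S].
    by move=> ? ? ? ? S; rewrite /S; split; lra.
  have [h1 h2 h3 h4] := lt4 _ _ _ _ (s0 true true) (s0 true false) (s0 false true) (s0 false false).
  case: b1; case: b2; [exact: h1|exact: h2|exact: h3|exact: h4].
have N1 := level_set_graph g1 hc.
have N2 := near_second_derivative hM.
near=> e.
have e0 : 0 < e by near: e; exact: nbhs_right_gt.
have H1 : forall y z, ball x e y -> ball x e z -> g y = g z ->
  enorm (y - z) <= c * `|coor (~~ b) y - coor (~~ b) z| by near: e.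
have H2 : forall y, ball x e y -> forall b1 b2, `|partial b1 (partial b2 u) y| <= M.
  by near: e.
apply: negligible_image => eta eta0.
(* N cells of width 2 e / N, each with an image of length 8 M (c 2 e / N)^2. *)
pose C := 8 * M * (c * (2 * e)) ^+ 2.
have C0 : 0 <= C by rewrite mulr_ge0 ?mulr_ge0 ?sqr_ge0.
have [n] : exists n : nat, C * n.+1%:R^-1 < eta.
  by have [N _ /(_ N (leqnn _))] := near_scaled_harmonic_lt C eta0; exists N.
move=> hn; set N := n.+1 in hn.
have N0 : 0 < N%:R :> R by [].
pose a := coor (~~ b) x - e.
pose wd := 2 * e / N%:R; have wd0 : 0 < wd by rewrite divr_gt0 ?mulr_gt0.
exists N, (fun i => [set y | a + i%:R * wd <= coor (~~ b) y < a + i%:R * wd + wd]).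
exists (4 * M * (c * wd) ^+ 2); split.
- by rewrite mulr_ge0 ?mulr_ge0 ?sqr_ge0.
- apply: le_trans (ltW hn); rewrite le_eqVlt; apply/orP; left; apply/eqP.
  by rewrite /C /wd; field; rewrite gt_eqF.
- move=> y [_ /ball_coord/(_ (~~ b))]; rewrite ltr_norml => hy.
  have [|i Hi] := @exists_cell R a (2 * e) (coor (~~ b) y) N (mulr_gt0 (ltr0Sn _ 1) e0) isT.
    by rewrite /a; lra.
  by exists i; [exact: ltn_ord|exact: Hi].
- move=> i y z /= yi zi [yc yb] [zc zb].
  apply: (critical_taylor u2 _ zb yb zc); first by move=> b1 b2 v /H2; apply.
  move=> b1; rewrite -coordB; apply: le_trans (coord_le_enorm b1 _) _.
  apply: le_trans (H1 _ _ yb zb _) _; first by rewrite /g !Du_0.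
  by apply: ler_wpM2l => //; rewrite ler_norml; lra.
Unshelve. all: by end_near. Qed.

Let crit2 := crit `&` [set x | forall b b', partial b (partial b' u) x = 0].

Lemma closed_crit2 : closed crit2.
Proof.
have cl (f : R * R -> R) : continuous f -> closed [set x | f x = 0].
  move=> cf; rewrite (_ : [set x | f x = 0] = f @^-1` [set y | y = 0])//.
  by apply: preimage_closed => // x _; exact: cf.
have -> : crit2 = \bigcap_b ([set x | partial b u x = 0] `&`
    \bigcap_b' [set x | partial b (partial b' u) x = 0]).
  apply/seteqP; split => [x [xc x2] b _|x H].
    by split; [exact: Du_0|move=> b' _; exact: x2].
  split; last by move=> b b'; have [_] := H b I; apply.
  by rewrite /crit /= /grad; have [+ _] := H true I; have [+ _] := H false I => /= -> ->.
apply: closed_bigI => b _; apply: closedI; first by apply: cl; exact: (Ck1_continuous u2).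
by apply: closed_bigI => b' _; apply: cl; exact: (Ck1_continuous (Ck_partial b' u2)).
Qed.

(** Where all second derivatives vanish, u varies by o(h^2) on a square of side
    h, uniformly on compact sets, and there are O(h^-2) squares. *)
Lemma sard_flat (M : R) : 0 < M ->
  lambda.-negligible (u @` (crit2 `&` square (- M, - M) (2 * M))).
Proof.
move=> M0; apply: negligible_image => eta eta0.
(* N^2 squares of side 2 M / N, each with an image of length 8 eps (2 M / N)^2. *)
pose eps := eta / (32 * M ^+ 2).
have M20 : 0 < 32 * M ^+ 2 by rewrite mulr_gt0 ?exprn_gt0.
have eps0 : 0 < eps by rewrite divr_gt0.
pose K := crit2 `&` (`[- M, M]%classic `*` `[- M, M]%classic).
have cK : compact K.
  apply: (@subclosed_compact _ _ (`[- M, M]%classic `*` `[- M, M]%classic)).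
  - apply: closedI; first exact: closed_crit2.
    by apply: compact_closed; [exact: norm_hausdorff|apply: compact_setX; exact: segment_compact].
  - by apply: compact_setX; exact: segment_compact.
  - by move=> x [].
have [n Hn] : exists n, K `<=` (fun x => forall y, ball x (2 * M / n.+1%:R) y ->
    forall b b', `|partial b (partial b' u) y| <= eps).
  suff : \forall n \near \oo, K `<=` (fun x => forall y, ball x (2 * M / n.+1%:R) y ->
      forall b b', `|partial b (partial b' u) y| <= eps).
    by move=> [N _ /(_ N (leqnn _))]; exists N.
  apply: (proj1 (compact_near_coveringP _) cK) => x [[_ x2] _].
  have /near_second_derivative : forall b b', `|partial b (partial b' u) x| < eps.
    by move=> b b'; rewrite x2 normr0.
  move=> H; have [e [e0 He]] := filter_ex (filterI (nbhs_right_gt 0) H).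
  have e20 : 0 < e / 2 by rewrite divr_gt0.
  exists (ball x (e / 2), [set n | 2 * M * n.+1%:R^-1 < e / 2]).
    by split; [exact: nbhsx_ballx|exact: near_scaled_harmonic_lt].
  move=> [y n] [/= yx hn] z yz; apply: He.
  by rewrite (splitr e); apply: ball_triangle yx _; apply: le_ball yz; exact: ltW.
set N := n.+1 in Hn; have N0 : 0 < N%:R :> R by [].
exists (N * N)%N, (grid_square M N), (4 * eps * (2 * M / N%:R) ^+ 2); split.
- by rewrite mulr_ge0 ?sqr_ge0// mulr_ge0// ltW.
- rewrite le_eqVlt; apply/orP; left; apply/eqP.
  by rewrite /eps natrM; field; rewrite !gt_eqF.
- by move=> x [_ xM]; have [k kN xk] := grid_cover M0 (ltn0Sn n) xM; exists k.
- move=> k x y xk yk [xc xM] [yc yM].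
  have yK : K y.
    by split => //; split; rewrite /= in_itv /=; have := yM true; have := yM false => /=; lra.
  have h0 : 0 < 2 * M / N%:R by rewrite divr_gt0 ?mulr_gt0.
  apply: (critical_taylor u2 (c := y) (e := 2 * M / N%:R) (x := y)).
  - by move=> b b' z zb; exact: (Hn _ yK).
  - exact: ballxx.
  - exact: square_ball yk xk.
  - by case: yc.
  - move=> b; rewrite distrC ltW//.
    by have /ball_coord/(_ b) := square_ball yk xk.
Qed.

Lemma small_grid_square (x : R * R) (e : R) : 0 < e -> exists m n k : nat,
  grid_square m.+1%:R n.+1 k x /\ grid_square m.+1%:R n.+1 k `<=` ball x e.
Proof.
move=> e0.
have [m xQ] := square_exhaust x; set M : R := m.+1%:R in xQ *.
have M0 : 0 < M by [].
have [n _ /(_ n (leqnn _)) /= hn] := near_scaled_harmonic_lt (2 * M) e0.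
have [k _ xk] := grid_cover M0 (ltn0Sn n) xQ.
exists m, n, k; split => // y yk; apply: le_ball (square_ball xk yk); exact: ltW.
Qed.

(** Countably many grid squares carry the critical points at which some second
    derivative is nonzero, by [sard_curve], and [sard_flat] deals with the
    others. *)
Theorem sard : lambda.-negligible (u @` [set x | grad u x = 0]).
Proof.
pose F m n k : set R :=
  if pselect (lambda.-negligible (u @` (crit `&` grid_square m.+1%:R n.+1 k)))
  then u @` (crit `&` grid_square m.+1%:R n.+1 k) else set0.
have NF m n k : lambda.-negligible (F m n k).
  by rewrite /F; case: pselect => //= _; exact: negligible_set0.
have N1 : lambda.-negligible (\bigcup_m \bigcup_n \bigcup_k F m n k).
  by do 3 (apply: negligible_bigcup => ?); exact: NF.
have N2 : lambda.-negligible (\bigcup_m (u @` (crit2 `&` square (- m.+1%:R, - m.+1%:R) (2 * m.+1%:R)))).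
  by apply: negligible_bigcup => m; exact: sard_flat.
apply: negligibleS (negligibleU N1 N2) => _ [x xc <-].
have [x2|] := pselect (forall b b', partial b (partial b' u) x = 0).
  by right; have [m xm] := square_exhaust x; exists m => //; exists x => //; split.
move=> /existsNP[b /existsNP[b' /eqP x0]]; left.
have [e [e0 He]] := filter_ex (filterI (nbhs_right_gt 0) (sard_curve x0)).
have [m [n [k [xk ke]]]] := small_grid_square x e0.
exists m => //; exists n => //; exists k => //; rewrite /F; case: pselect => /= [_|[]].
  by exists x.
apply: negligibleS He => _ [y [yc yk] <-]; exists y => //; split => //; exact: ke.
Qed.

End sard.

(** * Smoothness of superlevel sets *)

Section frame.
Context {R : realType}.
Variables (a b : R).
Hypothesis ab1 : a ^+ 2 + b ^+ 2 = 1.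

Definition frame_point (s y : R) : R * R := (a * s - b * y, b * s + a * y).
Definition frame_s (x : R * R) : R := a * x.1 + b * x.2.
Definition frame_y (x : R * R) : R := - b * x.1 + a * x.2.

Lemma frame_pointK x : frame_point (frame_s x) (frame_y x) = x.
Proof.
case: x => x1 x2; rewrite /frame_point /frame_s /frame_y /=; congr (_, _).
- by rewrite -[RHS](mul1r x1) -ab1; ring.
- by rewrite -[RHS](mul1r x2) -ab1; ring.
Qed.

Lemma frame_norm x : enorm x ^+ 2 = frame_s x ^+ 2 + frame_y x ^+ 2.
Proof.
by rewrite sqr_enorm -[LHS]mul1r -ab1 /frame_s /frame_y; ring.
Qed.

Lemma frame_sB x y : frame_s (x - y) = frame_s x - frame_s y.
Proof. by rewrite /frame_s /=; ring. Qed.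

Lemma frame_yB x y : frame_y (x - y) = frame_y x - frame_y y.
Proof. by rewrite /frame_y /=; ring. Qed.

Lemma frame_s_le x : `|frame_s x| <= enorm x.
Proof.
rewrite -ler_sqr ?nnegrE ?enorm_ge0// frame_norm real_normK ?num_real//.
by rewrite lerDl sqr_ge0.
Qed.

Lemma frame_y_le x : `|frame_y x| <= enorm x.
Proof.
rewrite -ler_sqr ?nnegrE ?enorm_ge0// frame_norm real_normK ?num_real//.
by rewrite lerDr sqr_ge0.
Qed.

Lemma frame_ball x (e s y : R) : `|s - frame_s x| < e / 2 -> `|y - frame_y x| < e / 2 ->
  ball x e (frame_point s y).
Proof.
have a1 : `|a| <= 1.
  by rewrite -ler_sqr ?nnegrE// real_normK ?num_real// expr1n -ab1 lerDl sqr_ge0.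
have b1 : `|b| <= 1.
  by rewrite -ler_sqr ?nnegrE// real_normK ?num_real// expr1n -ab1 lerDr sqr_ge0.
move=> se ye; have K (c d p q : R) : `|c| <= 1 -> `|d| <= 1 -> `|p| < e / 2 -> `|q| < e / 2 ->
    `|c * p + d * q| < e.
  move=> c1 d1 pe qe; apply: (le_lt_trans (ler_normD _ _)); rewrite !normrM.
  have := ler_piMl (normr_ge0 p) c1; have := ler_piMl (normr_ge0 q) d1; lra.
rewrite -{1}(frame_pointK x); split; rewrite /ball /= distrC.
- rewrite (_ : _ - _ = a * (s - frame_s x) + (- b) * (y - frame_y x)); last by ring.
  by apply: K; rewrite ?normrN.
- rewrite (_ : _ - _ = b * (s - frame_s x) + a * (y - frame_y x)); last by ring.
  exact: K.
Qed.

Definition tangential (v : R * R -> R) (x : R * R) := a * partial1 v x + b * partial2 v x.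
Definition normal (v : R * R -> R) (x : R * R) := - b * partial1 v x + a * partial2 v x.

Lemma frame_MVT (v : R * R -> R) c (e s y s' y' : R) : (forall z, differentiable v z) ->
  ball c e (frame_point s y) -> ball c e (frame_point s' y') ->
  exists2 z, ball c e z & v (frame_point s' y') - v (frame_point s y) =
    (s' - s) * tangential v z + (y' - y) * normal v z.
Proof.
move=> dv c1 c2; have [z [cz _ E]] := ball_MVT true dv c1 c2.
by exists z => //; rewrite E /partial /coor /tangential /normal /=; ring.
Qed.

Lemma continuous_normal v : Ck 1 v -> continuous (normal v).
Proof.
move=> [_ c1 c2] x; apply: cvgD; apply: cvgM; try exact: cvg_cst.
  exact: (c1 x).
exact: (c2 x).
Qed.

Lemma continuous_tangential v : Ck 1 v -> continuous (tangential v).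
Proof.
move=> [_ c1 c2] x; apply: cvgD; apply: cvgM; try exact: cvg_cst.
  exact: (c1 x).
exact: (c2 x).
Qed.

Section level_curve.
Variables (v : R * R -> R) (x0 : R * R) (t : R).
Hypotheses (v1 : Ck 1 v) (vx0 : v x0 = t) (nu0 : 0 < normal v x0).
Notation s0 := (frame_s x0).
Notation y0 := (frame_y x0).

Let dv z : differentiable v z.
Proof. by case: v1. Qed.

Lemma continuous_frame_point (T : topologicalType) (h k : T -> R) (z : T) :
  {for z, continuous h} -> {for z, continuous k} ->
  {for z, continuous (fun x => frame_point (h x) (k x))}.
Proof.
move=> ch ck.
have c1 : a * h x - b * k x @[x --> z] --> a * h z - b * k z.
  by apply: cvgB; (apply: cvgM; first exact: cvg_cst); [exact: ch|exact: ck].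
have c2 : b * h x + a * k x @[x --> z] --> b * h z + a * k z.
  by apply: cvgD; (apply: cvgM; first exact: cvg_cst); [exact: ch|exact: ck].
exact: (cvg_pair c1 c2).
Qed.

Let cont_s (y s : R) : v (frame_point s' y) @[s' --> s] --> v (frame_point s y).
Proof.
apply: (@continuous_comp _ _ _ (fun s' => frame_point s' y) v); last exact: (continuous_of_Ck v1).
by apply: continuous_frame_point; [exact: cvg_id|exact: cvg_cst].
Qed.

Let cont_y (s y : R) : v (frame_point s y') @[y' --> y] --> v (frame_point s y).
Proof.
apply: (@continuous_comp _ _ _ (fun y' => frame_point s y') v); last exact: (continuous_of_Ck v1).
by apply: continuous_frame_point; [exact: cvg_cst|exact: cvg_id].
Qed.

(** Near [x0] the function [v] increases with the second coordinate in the
    frame, so by the intermediate value theorem each first coordinate close to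
    that of [x0] has exactly one level point. The property [P] is carried along
    so that a single radius serves for it too. *)
Lemma level_curve (P : R * R -> Prop) : (\forall x \near x0, P x) ->
  exists (rho : R) (g : R -> R),
  [/\ 0 < rho,
    (forall s, ball s0 rho s -> v (frame_point s (g s)) = t),
    (forall s, ball s0 rho s -> {for s, continuous g}),
    (forall s, ball s0 rho s -> 0 < normal v (frame_point s (g s))) &
    (forall x, enorm (x - x0) < rho -> P x /\ (t < v x <-> g (frame_s x) < frame_y x))].
Proof.
move=> nP.
have nn : \forall x \near x0, 0 < normal v x.
  have c : normal v x @[x --> x0] --> normal v x0 by exact: (continuous_normal v1).
  exact: (cvgr_gt _ c _ nu0).
have [e [e0 [He HP]]] := filter_ex (filterI (nbhs_right_gt 0)
  (filterI (near_ball_sub nn) (near_ball_sub nP))).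
pose eta := e / 4; have eta0 : 0 < eta by rewrite divr_gt0.
have etae : eta < e / 2 by rewrite /eta; lra.
have box s y : `|s - s0| <= eta -> `|y - y0| <= eta -> ball x0 e (frame_point s y).
  by move=> hs hy; apply: frame_ball; exact: le_lt_trans etae.
have mono s y y' : `|s - s0| <= eta -> `|y - y0| <= eta -> `|y' - y0| <= eta ->
    y < y' -> v (frame_point s y) < v (frame_point s y').
  move=> hs hy hy' yy'; rewrite -subr_gt0.
  have [z /He nz ->] := frame_MVT dv (box _ _ hs hy) (box _ _ hs hy').
  by rewrite subrr mul0r add0r mulr_gt0// subr_gt0.
have mono_iff s y y' : `|s - s0| <= eta -> `|y - y0| <= eta -> `|y' - y0| <= eta ->
    v (frame_point s y) < v (frame_point s y') <-> y < y'.
  move=> hs hy hy'; split; last exact: mono.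
  rewrite !ltNge; apply: contra; rewrite le_eqVlt => /predU1P[->//|yy'].
  by apply: ltW; exact: mono.
have n0 : `|y0 - y0| <= eta by rewrite subrr normr0 ltW.
have np : `|y0 + eta - y0| <= eta by rewrite addrAC subrr add0r gtr0_norm.
have nm : `|y0 - eta - y0| <= eta by rewrite addrAC subrr add0r normrN gtr0_norm.
have m0 : `|s0 - s0| <= eta by rewrite subrr normr0 ltW.
have fx0 : v (frame_point s0 y0) = t by rewrite frame_pointK.
have lo : v (frame_point s0 (y0 - eta)) < t.
  by rewrite -fx0; apply: mono => //; rewrite ltrBlDr ltrDl.
have hi : t < v (frame_point s0 (y0 + eta)).
  by rewrite -fx0; apply: mono => //; rewrite ltrDl.
have Nlo : \forall s \near nbhs s0, v (frame_point s (y0 - eta)) < t.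
  exact: (cvgr_lt _ (@cont_s _ _) _ lo).
have Nhi : \forall s \near nbhs s0, t < v (frame_point s (y0 + eta)).
  exact: (cvgr_gt _ (@cont_s _ _) _ hi).
have [d /= d0 Hd] := filterI Nlo Nhi.
pose rho := Num.min d eta.
have rho0 : 0 < rho by rewrite lt_min d0 eta0.
have inI s : ball s0 rho s -> `|s - s0| <= eta.
  by rewrite /ball /= distrC lt_min => /andP[_ /ltW].
have /choice[g Hg] s : exists y, ball s0 rho s ->
    `|y - y0| < eta /\ v (frame_point s y) = t.
  have [sI|nI] := pselect (ball s0 rho s); last by exists 0.
  have /Hd[slo shi] : `|s0 - s| < d.
    by move: sI; rewrite /ball /= lt_min => /andP[].
  have se := inI _ sI.
  have le : y0 - eta <= y0 + eta by lra.
  have cw : {within `[y0 - eta, y0 + eta], continuous (fun y => v (frame_point s y))}.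
    by apply: continuous_subspaceT => y; exact: cont_y.
  have tw : Num.min (v (frame_point s (y0 - eta))) (v (frame_point s (y0 + eta))) <= t <=
      Num.max (v (frame_point s (y0 - eta))) (v (frame_point s (y0 + eta))).
    by rewrite ge_min le_max (ltW slo) (ltW shi) orbT.
  have [y] := IVT le cw tw.
  rewrite in_itv /= => /andP[y1 y2] vy; exists y => _; split => //.
  move: y1 y2; rewrite !le_eqVlt => /predU1P[E|y1].
    by move: slo; rewrite E vy ltxx.
  move=> /predU1P[E|y2]; first by move: shi; rewrite -E vy ltxx.
  by rewrite ltr_norml; lra.
exists rho, g; split => //.
- by move=> s /Hg[].
- move=> s sI; have [gs1 gs2] := Hg _ sI.
  apply/cvgrPdist_lt => eps eps0.
  have gs3 : 0 < eta - `|g s - y0| by rewrite subr_gt0.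
  pose k := Num.min (eps / 2) (eta - `|g s - y0|).
  have k0 : 0 < k by rewrite lt_min divr_gt0.
  have ke : k < eps by rewrite gt_min; apply/orP; left; lra.
  have kb (c : R) : `|c| <= k -> `|g s + c - y0| <= eta.
    rewrite le_min => /andP[_ ck].
    by rewrite addrAC; apply: le_trans (ler_normD _ _) _; lra.
  have kp : `|g s + k - y0| <= eta by apply: kb; rewrite gtr0_norm.
  have km : `|g s - k - y0| <= eta by apply: kb; rewrite normrN gtr0_norm.
  have lo' : v (frame_point s (g s - k)) < t.
    by rewrite -gs2; apply: mono; rewrite ?inI// ?ltW// ltrBlDr ltrDl.
  have hi' : t < v (frame_point s (g s + k)).
    by rewrite -gs2; apply: mono; rewrite ?inI// ?ltW// ltrDl.
  have nI : nbhs s (ball s0 rho).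
    by apply: open_nbhs_nbhs; split => //; exact: ball_open.
  near=> s'.
  have s'I : ball s0 rho s' by near: s'; exact: nI.
  have [g1 g2] := Hg _ s'I.
  have : v (frame_point s' (g s - k)) < v (frame_point s' (g s')).
    by rewrite g2; near: s'; exact: (cvgr_lt _ (@cont_s _ _) _ lo').
  rewrite mono_iff ?inI// ?ltW// => l1.
  have : v (frame_point s' (g s')) < v (frame_point s' (g s + k)).
    by rewrite g2; near: s'; exact: (cvgr_gt _ (@cont_s _ _) _ hi').
  rewrite mono_iff ?inI// ?ltW// => l2.
  by rewrite ltr_norml; lra.
- move=> s sI; have [gs1 _] := Hg _ sI.
  by apply: He; apply: box; [exact: inI|exact: ltW].
move=> x xr.
have xs : `|frame_s x - s0| < rho by rewrite -frame_sB; exact: le_lt_trans (frame_s_le _) xr.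
have xy : `|frame_y x - y0| < rho by rewrite -frame_yB; exact: le_lt_trans (frame_y_le _) xr.
have sI : ball s0 rho (frame_s x) by rewrite /ball /= distrC.
have xye : `|frame_y x - y0| <= eta by apply: ltW; move: xy; rewrite lt_min => /andP[].
split; first by rewrite -(frame_pointK x); apply: HP; apply: box => //; exact: inI.
have [g1 g2] := Hg _ sI.
rewrite -[in v x](frame_pointK x) -g2; apply: mono_iff => //; first exact: inI.
exact: ltW.
Unshelve. all: by end_near. Qed.

End level_curve.

End frame.

Section curve_smoothness.
Context {R : realType}.
Variables (a b : R) (v : R * R -> R) (t s0 rho : R) (g : R -> R).
Hypotheses (ab1 : a ^+ 2 + b ^+ 2 = 1) (sv : smooth v).
Notation curve s := (frame_point a b s (g s)).
Hypotheses (vg : forall s, ball s0 rho s -> v (curve s) = t)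
  (cg : forall s, ball s0 rho s -> {for s, continuous g})
  (nu_gt0 : forall s, ball s0 rho s -> 0 < normal a b v (curve s)).

Let v1 : Ck 1 v := sv 1.

Let dv z : differentiable v z.
Proof. by case: v1. Qed.

Let continuous_curve s : ball s0 rho s -> curve s' @[s' --> s] --> curve s.
Proof. by move=> /cg c; apply: continuous_frame_point; [exact: cvg_id|exact: c]. Qed.

Let slope s := - tangential a b v (curve s) / normal a b v (curve s).

(** The mean value theorem between two points of the level curve expresses the
    difference quotient of [g] by the gradient at an intermediate point, which
    converges by continuity. *)
Lemma is_derive_implicit s : ball s0 rho s -> is_derive s 1 g (slope s).
Proof.
move=> sI.
suff cv : (fun h => h^-1 *: (g (h *: 1 + s) - g s)) @ 0^' --> slope s.
  by apply: DeriveDef; [apply: cvgP cv|exact: cvg_lim].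
have cG : - tangential a b v z / normal a b v z @[z --> curve s] --> slope s.
  apply: cvgM; first by apply: cvgN; exact: continuous_tangential.
  by apply: cvgV; [rewrite gt_eqF// nu_gt0|exact: continuous_normal].
have cN : normal a b v z @[z --> curve s] --> normal a b v (curve s).
  exact: continuous_normal.
apply/cvgrPdist_lt => e e0.
have nG : \forall z \near nbhs (curve s), `|slope s - (- tangential a b v z / normal a b v z)| < e.
  exact: (cvgr_dist_lt _ _ cG).
have nN : \forall z \near nbhs (curve s), 0 < normal a b v z.
  exact: (cvgr_gt _ cN _ (nu_gt0 sI)).
have [d [d0 [dG dN]]] := filter_ex (filterI (nbhs_right_gt 0)
  (filterI (near_ball_sub nG) (near_ball_sub nN))).
have nc : \forall s' \near nbhs s, ball (curve s) d (curve s').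
  exact: (continuous_curve sI (nbhsx_ballx _ _ d0)).
have nI : \forall s' \near nbhs s, ball s0 rho s'.
  by apply: open_nbhs_nbhs; split => //; exact: ball_open.
have cs : (fun h : R => h *: 1 + s) h @[h --> 0^'] --> s.
  apply: (@cvg_trans _ ((h + s) @[h --> 0^'])).
    by apply: near_eq_cvg; near=> h; rewrite [h *: 1]mulr1.
  have : h + s @[h --> 0^'] --> 0 + s.
    by apply: cvgD; [exact: cvg_within|exact: cvg_cst].
  by rewrite add0r.
near=> h.
have h0 : h != 0 by near: h; exact: nbhs_dnbhs_neq.
have hI : ball s0 rho (h *: 1 + s) by near: h; exact: (cs _ nI).
have hc : ball (curve s) d (curve (h *: 1 + s)) by near: h; exact: (cs _ nc).
have [z zd] := frame_MVT dv (ballxx (curve s) d0) hc.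
rewrite (vg hI) (vg sI) subrr => /esym/eqP.
rewrite [h *: 1]mulr1 addrK addr_eq0 => /eqP E.
have nz : 0 < normal a b v z := dN _ zd.
have -> : h^-1 *: (g (h + s) - g s) = - tangential a b v z / normal a b v z.
  rewrite /GRing.scale /=; apply: (mulfI h0); rewrite mulVKf//.
  by rewrite mulrA mulrN E opprK mulfK// gt_eqF.
exact: dG.
Unshelve. all: by end_near. Qed.

(** The derivative of [g] belongs to this class, and the class is stable under
    differentiation on the interval, which gives all the derivatives of [g] at
    once. *)
Inductive curve_fun : (R -> R) -> Prop :=
| curve_cst k : curve_fun (fun=> k)
| curve_smooth w : smooth w -> curve_fun (fun s => w (curve s))
| curve_add h k : curve_fun h -> curve_fun k -> curve_fun (fun s => h s + k s)
| curve_mul h k : curve_fun h -> curve_fun k -> curve_fun (fun s => h s * k s)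
| curve_inv : curve_fun (fun s => (normal a b v (curve s))^-1).

Lemma curve_fun_slope : curve_fun slope.
Proof.
rewrite (_ : slope = fun s => -1 * (a * partial1 v (curve s) + b * partial2 v (curve s)) *
    (normal a b v (curve s))^-1); last first.
  by apply/funext => s; rewrite /slope /tangential mulN1r.
apply: curve_mul; last exact: curve_inv.
apply: curve_mul; first exact: curve_cst.
by apply: curve_add; apply: curve_mul; try exact: curve_cst; apply: curve_smooth;
  [exact: smooth_partial1|exact: smooth_partial2].
Qed.

Lemma is_derive_curve w s : (forall z, differentiable w z) -> ball s0 rho s ->
  is_derive s 1 (fun s => w (curve s))
    ((a + - b * slope s) * partial1 w (curve s) + (b + a * slope s) * partial2 w (curve s)).
Proof.
move=> dw sI; have dg := is_derive_implicit sI.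
have d1 : is_derive s 1 (fun s => a * s - b * g s) (a + - b * slope s).
  have := is_deriveD (is_deriveZ a (is_derive_id s 1)) (is_deriveZ (- b) dg).
  rewrite (_ : _ + _ = fun s => a * s - b * g s) //.
    by rewrite /GRing.scale /= mulr1.
  by apply/funext => x; rewrite -[LHS]/(a * x + - b * g x) mulNr.
have d2 : is_derive s 1 (fun s => b * s + a * g s) (b + a * slope s).
  have := is_deriveD (is_deriveZ b (is_derive_id s 1)) (is_deriveZ a dg).
  by rewrite /GRing.scale /= mulr1.
have f1 : differentiable (fun s => a * s - b * g s) s.
  by apply/derivable1_diffP; exact: (@ex_derive _ _ _ _ _ _ _ d1).
have f2 : differentiable (fun s => b * s + a * g s) s.
  by apply/derivable1_diffP; exact: (@ex_derive _ _ _ _ _ _ _ d2).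
have f12 : differentiable (fun s => curve s) s by exact: differentiable_pair.
have dwc : differentiable (w \o (fun s => curve s)) s.
  by apply: differentiable_comp => //; exact: dw.
apply: DeriveDef; first exact/derivable1_diffP.
rewrite deriveE// (@diff_comp _ _ _ _ (fun s => curve s) w)//=.
rewrite (_ : 'd _ s 1 = (a + - b * slope s, b + a * slope s)); last first.
  rewrite diff_pair//=; congr (_, _).
    by rewrite -deriveE//; exact: (@derive_val _ _ _ _ _ _ _ d1).
  by rewrite -deriveE//; exact: (@derive_val _ _ _ _ _ _ _ d2).
by rewrite -deriveE// derive_plane.
Qed.

Lemma curve_fun_derive h : curve_fun h -> exists2 k, curve_fun k &
  forall s, ball s0 rho s -> is_derive s 1 h (k s).
Proof.
have D w : smooth w -> exists2 k, curve_fun k &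
    forall s, ball s0 rho s -> is_derive s 1 (fun s => w (curve s)) (k s).
  move=> sw; exists (fun s => (a + - b * slope s) * partial1 w (curve s) +
    (b + a * slope s) * partial2 w (curve s)).
    apply: curve_add; apply: curve_mul; last 2 first.
    - by apply: curve_add; [exact: curve_cst|apply: curve_mul; [exact: curve_cst|exact: curve_fun_slope]].
    - exact/curve_smooth/smooth_partial2.
    - by apply: curve_add; [exact: curve_cst|apply: curve_mul; [exact: curve_cst|exact: curve_fun_slope]].
    - exact/curve_smooth/smooth_partial1.
  by move=> s sI; apply: is_derive_curve => // z; have [] := sw 1%N.
elim=> [k|w /D//|h1 h2 _ [k1 c1 d1] _ [k2 c2 d2]|h1 h2 p1 [k1 c1 d1] p2 [k2 c2 d2]|].
- exists (fun=> 0); first exact: curve_cst.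
  by move=> s _; exact: is_derive_cst.
- exists (fun s => k1 s + k2 s); first exact: curve_add.
  by move=> s sI; apply: is_deriveD; [exact: d1|exact: d2].
- exists (fun s => h1 s * k2 s + h2 s * k1 s).
    by apply: curve_add; exact: curve_mul.
  by move=> s sI; apply: is_deriveM; [exact: d1|exact: d2].
have [k1 c1 d1] := D _ (smooth_partial1 sv).
have [k2 c2 d2] := D _ (smooth_partial2 sv).
pose N s := normal a b v (curve s).
exists (fun s => -1 * ((N s)^-1 * (N s)^-1) * (- b * k1 s + a * k2 s)).
  apply: curve_mul.
    apply: curve_mul; first exact: curve_cst.
    by apply: curve_mul; exact: curve_inv.
  by apply: curve_add; apply: curve_mul => //; exact: curve_cst.
move=> s sI.
have dN : is_derive s 1 N (- b * k1 s + a * k2 s).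
  exact: (is_deriveD (is_deriveZ (- b) (d1 s sI)) (is_deriveZ a (d2 s sI))).
have N0 : N s != 0 by rewrite gt_eqF// nu_gt0.
have eN : derivable N s 1 by exact: (@ex_derive _ _ _ _ _ _ _ dN).
apply: DeriveDef; first exact: (derivableV N0 eN).
rewrite (deriveV N0 eN) (@derive_val _ _ _ _ _ _ _ dN) /GRing.scale /=.
by rewrite expr2 invfM mulN1r.
Qed.

Lemma smooth_on_implicit : smooth_on (ball s0 rho) g.
Proof.
suff H n : exists2 k, curve_fun k & forall s, ball s0 rho s -> is_derive s 1 (derive1n n g) (k s).
  by move=> n s sI; have [k _ dk] := H n; exact: (@ex_derive _ _ _ _ _ _ _ (dk s sI)).
elim: n => [|n [k ck dk]]; first by exists slope; [exact: curve_fun_slope|exact: is_derive_implicit].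
have [k' ck' dk'] := curve_fun_derive ck; exists k' => // s sI.
apply: near_eq_is_derive (dk' s sI).
have nI : \forall s' \near nbhs s, ball s0 rho s'.
  by apply: open_nbhs_nbhs; split => //; exact: ball_open.
apply: (filterS _ nI) => s' s'I.
by rewrite derive1nS derive1E (@derive_val _ _ _ _ _ _ _ (dk s' s'I)).
Qed.

End curve_smoothness.

Section smooth_superlevel.
Context {R : realType}.
Implicit Types (u v : R * R -> R) (A : set (R * R)).

Lemma graph_at_regular_point v A x0 t : smooth v -> v x0 = t -> grad v x0 != 0 ->
  (\forall x \near x0, A x <-> t < v x) ->
  exists (a b rho : R) (g : R -> R),
    [/\ a ^+ 2 + b ^+ 2 = 1, 0 < rho,
        smooth_on (ball (a * x0.1 + b * x0.2) rho) g &
        forall x, enorm (x - x0) < rho ->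
          (A x <-> g (a * x.1 + b * x.2) < - b * x.1 + a * x.2)].
Proof.
move=> sv vx0 gx0 nA.
pose D := enorm (grad v x0); have D0 : 0 < D by rewrite enorm_gt0.
have D2 : D ^+ 2 = partial1 v x0 ^+ 2 + partial2 v x0 ^+ 2 by rewrite sqr_enorm.
(* The second axis of the frame is directed by the gradient. *)
pose a := partial2 v x0 / D; pose b := - partial1 v x0 / D.
have ab1 : a ^+ 2 + b ^+ 2 = 1.
  by rewrite /a /b !expr_div_n sqrrN -mulrDl addrC -D2 divff// expf_neq0// gt_eqF.
have nu0 : 0 < normal a b v x0.
  rewrite (_ : normal _ _ _ _ = D ^+ 2 / D); first by rewrite divr_gt0// exprn_gt0.
  by rewrite D2 /normal /a /b; ring.
have [rho [g [rho0 g1 g2 g3 g4]]] := level_curve ab1 (sv 1%N) vx0 nu0 nA.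
exists a, b, rho, g; split => //.
  exact: (smooth_on_implicit sv g1 g2 g3).
by move=> x /g4[-> ].
Qed.

Lemma open_superlevel u (t : R) : continuous u -> open [set x | t < `|u x|].
Proof.
move=> cu; rewrite (_ : [set _ | _] = (fun x => `|u x|) @^-1` [set y | t < y])//.
by apply: open_comp => // x _; apply: cvg_norm; exact: cu.
Qed.

Lemma boundary_superlevel u (t : R) x : continuous u ->
  boundary [set x | t < `|u x|] x -> `|u x| = t.
Proof.
move=> cu [clx]; have /interior_id -> := @open_superlevel u t cu.
move=> /negP; rewrite -leNgt => xt; apply/eqP; rewrite eq_le xt/= leNgt; apply/negP => tx.
have cn : `|u y| @[y --> x] --> `|u x| by apply: cvg_norm; exact: cu.
have [y [/= ty]] := clx _ (cvgr_lt _ cn _ tx).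
by move=> /(lt_trans ty); rewrite ltxx.
Qed.

(** A boundary point is on the level t of u or of - u, and {|u| > t} coincides
    near it with {u > t} or {- u > t}. *)
Lemma smooth_superlevel u (t : R) : smooth u -> 0 < t ->
  (forall x, `|u x| = t -> grad u x != 0) -> smooth_set [set x | t < `|u x|].
Proof.
move=> su t0 reg; have cu : continuous u := su 0%N.
split; first exact: open_superlevel.
move=> x0 /(boundary_superlevel cu) ux0.
have key v : smooth v -> v x0 = t -> grad v x0 != 0 -> (forall x, `|v x| = `|u x|) ->
    exists (a b rho : R) (g : R -> R),
    [/\ a ^+ 2 + b ^+ 2 = 1, 0 < rho,
        smooth_on (ball (a * x0.1 + b * x0.2) rho) g &
        forall x, enorm (x - x0) < rho ->
          ([set x | t < `|u x|] x <-> g (a * x.1 + b * x.2) < - b * x.1 + a * x.2)].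
  move=> sv vx0 gx0 uv; apply: (graph_at_regular_point sv vx0 gx0).
  have cv : v y @[y --> x0] --> v x0 by exact: (sv 0%N).
  have v0 : 0 < v x0 by rewrite vx0.
  have nv : \forall x \near nbhs x0, 0 < v x by exact: (cvgr_gt _ cv _ v0).
  by apply: (filterS _ nv) => x vx /=; rewrite -uv gtr0_norm.
have [u0|u0] := leP 0 (u x0).
  by apply: (key u) => //; [rewrite -ux0 ger0_norm|exact: reg].
apply: (key (\- u)); first exact: smoothN.
- by rewrite -ux0 ltr0_norm.
- have [du _ _] := su 1%N; rewrite /grad partial1N// partial2N//.
  apply: contra (reg _ ux0) => /eqP[/eqP p1 /eqP p2].
  by rewrite /grad; rewrite oppr_eq0 in p1; rewrite oppr_eq0 in p2; rewrite (eqP p1) (eqP p2).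
- by move=> x; rewrite normrN.
Qed.

End smooth_superlevel.

(** * Minkowski's inequality for layer cakes *)

Lemma measurable_lt_set d (T : measurableType d) (R : realType) (g h : T -> R) :
  measurable_fun setT g -> measurable_fun setT h ->
  measurable [set z | g z < h z].
Proof.
move=> mg mh; have m1 : measurable [set true] by [].
by have := measurable_fun_ltr mg mh measurableT m1; rewrite setTI.
Qed.

Section sigma_finite.
Context d (T : measurableType d) (R : realType) (mu : {measure set T -> \bar R}).
Hypothesis sf : sigma_finite [set: T] mu.

(** Alias of [mu] that carries the sigma-finite structure given by the proof. *)
Definition with_sigma_finite of sigma_finite [set: T] mu : set T -> \bar R := mu.

HB.instance Definition _ := Measure.on (with_sigma_finite sf).
HB.instance Definition _ := Measure_isSigmaFinite.Build d T R (with_sigma_finite sf) sf.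

Definition sigma_finite_measure_of : {sigma_finite_measure set T -> \bar R} :=
  with_sigma_finite sf.

End sigma_finite.

Section layer_cake.
Context d (T : measurableType d) {R : realType}.
Variable mu : {sigma_finite_measure set T -> \bar R}.
Variables (f W : T -> R) (r : R).
Hypotheses (mf : measurable_fun setT f) (mW : measurable_fun setT W).
Hypotheses (f0 : forall x, 0 <= f x) (W0 : forall x, 0 <= W x) (r1 : 1 <= r).
Local Open Scope ereal_scope.

Let r0 : (0 < r)%R.
Proof. exact: lt_le_trans r1. Qed.

Let mpow (h : T -> R) (s : R) : measurable_fun setT h ->
  measurable_fun setT (fun x => (h x `^ s)%R).
Proof. by move=> mh; apply: (measurableT_comp (measurable_powR s)). Qed.

(** For r = 1 the conjugate exponent is infinite, and both sides agree. *)
Lemma weighted_hoelder (E : set T) : measurable E ->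
  \int[mu]_x (\1_E x * (f x `^ (r - 1) * W x))%:E <=
  (\int[mu]_x (\1_E x * W x)%:E) `^ r^-1 * (\int[mu]_x (f x `^ r * W x)%:E) `^ (1 - r^-1).
Proof.
move=> mE; move: r1; rewrite le_eqVlt => /predU1P[<-|r1'].
  rewrite subrr invr1 subrr poweRe0 mule1 poweRe1; last first.
    by apply: integral_ge0 => x _; rewrite lee_fin mulr_ge0.
  by under eq_integral do rewrite powRr0 mul1r.
pose q := (r / (r - 1))%R.
have rN1 : (0 < r - 1)%R by rewrite subr_gt0.
have q0 : (0 < q)%R by rewrite divr_gt0.
have qV : (q^-1 = 1 - r^-1)%R by rewrite /q; field; rewrite !gt_eqF.
have rq : (r^-1 + q^-1 = 1)%R by rewrite qV; ring.
pose F x := (\1_E x * W x `^ r^-1)%R.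
pose G x := (f x `^ (r - 1) * W x `^ q^-1)%R.
have mF : measurable_fun setT F.
  by apply: measurable_funM; [exact: measurable_indic|exact: mpow].
have mG : measurable_fun setT G by apply: measurable_funM; exact: mpow.
have F0 x : (0 <= F x)%R by rewrite mulr_ge0 ?powR_ge0.
have G0 x : (0 <= G x)%R by rewrite mulr_ge0 ?powR_ge0.
have HH : 'N[mu]_1[EFin \o (F \* G)%R] <= 'N[mu]_r%:E[EFin \o F] * 'N[mu]_q%:E[EFin \o G].
  exact: (hoelder mu mF mG r0 q0 rq).
rewrite Lnorm1 in HH.
have N1 : \int[mu]_x `|(EFin \o (F \* G)%R) x| = \int[mu]_x (\1_E x * (f x `^ (r - 1) * W x))%:E.
  apply: eq_integral => x _; rewrite /= ger0_norm ?mulr_ge0 ?powR_ge0//.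
  congr (_%:E); rewrite /F /G mulrACA -powRD ?rq ?powRr1 ?oner_eq0//.
  by rewrite -mulrA.
have NF : 'N[mu]_r%:E[EFin \o F] = (\int[mu]_x (\1_E x * W x)%:E) `^ r^-1.
  rewrite unlock (eq_integral (fun x => (\1_E x * W x)%:E))// => x _.
  rewrite /= ger0_norm// powRM ?powR_ge0//.
  rewrite -powRrM mulVf ?gt_eqF// powRr1//; congr ((_ * _)%:E).
  by rewrite indicE; case: (_ \in _); rewrite ?powR1 ?powR0 ?gt_eqF.
have NG : 'N[mu]_q%:E[EFin \o G] = (\int[mu]_x (f x `^ r * W x)%:E) `^ (1 - r^-1).
  rewrite unlock qV (eq_integral (fun x => (f x `^ r * W x)%:E))// => x _.
  rewrite /= ger0_norm// powRM ?powR_ge0//.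
  rewrite -!powRrM mulVf ?gt_eqF// powRr1//; congr ((_ `^ _ * _)%:E).
  by rewrite /q; field; rewrite gt_eqF.
by rewrite N1 NF NG in HH.
Qed.

Let E (t : R) : set T := [set x | (t < f x)%R].

(** The function f is the integral over t > 0 of the indicators of {f > t}.
    Write A for the integral of f^r W, as the integral over t of f^(r-1) W on
    {f > t}; Hoelder's inequality bounds A by A^(1 - 1/r) times the integral of
    the norms of the layers. Finiteness of A allows the division. *)
Lemma minkowski_layer_cake : \int[mu]_x (f x `^ r * W x)%:E < +oo ->
  (\int[mu]_x (f x `^ r * W x)%:E) `^ r^-1 <=
  \int[lebesgue_measure]_(t in `]0%R, +oo[) (\int[mu]_x (\1_(E t) x * W x)%:E) `^ r^-1 /\
  measurable_fun setT (fun t : measurableTypeR R => (\int[mu]_x (\1_(E t) x * W x)%:E) `^ r^-1).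
Proof.
set A := \int[mu]_x _ => Afin.
have A0 : 0 <= A by apply: integral_ge0 => x _; rewrite lee_fin mulr_ge0 ?powR_ge0.
have mE t : measurable (E t).
  exact: (measurable_lt_set (measurable_cst t) mf).
pose S : set (T * measurableTypeR R) := [set z | (0 < z.2)%R] `&` [set z | (z.2 < f z.1)%R].
have m1f : measurable_fun setT (fun z : T * measurableTypeR R => f z.1).
  exact: measurableT_comp.
have mS2 : measurable [set z : T * measurableTypeR R | (z.2 < f z.1)%R].
  exact: (measurable_lt_set (@measurable_snd _ _ T (measurableTypeR R)) m1f).
have mS : measurable S.
  apply: measurableI => //.
  exact: (@measurable_lt_set _ _ R (fun=> 0%R) (fun z : T * measurableTypeR R => z.2)
    (measurable_cst _) (@measurable_snd _ _ T (measurableTypeR R))).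
have mg : measurable_fun setT (fun x => (f x `^ (r - 1) * W x)%R).
  by apply: measurable_funM => //; exact: mpow.
have mphi : measurable_fun setT (fun t : measurableTypeR R => \int[mu]_x (\1_(E t) x * W x)%:E).
  pose K (z : T * measurableTypeR R) := (\1_[set z : T * measurableTypeR R | (z.2 < f z.1)%R] z * W z.1)%:E.
  have mK : measurable_fun setT K.
    apply/measurable_EFinP; apply: measurable_funM; first exact: measurable_indic.
    exact: measurableT_comp.
  have := @measurable_fun_fubini_tonelli_G _ _ T (measurableTypeR R) R mu K mK _.
  rewrite /fubini_G; apply => z.
  by rewrite lee_fin mulr_ge0.
have mphir : measurable_fun setT (fun t : measurableTypeR R => (\int[mu]_x (\1_(E t) x * W x)%:E) `^ r^-1).
  exact: (measurableT_comp (measurable_poweR _)).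
split; last exact: mphir.
have [->|AN0] := eqVneq A 0.
  rewrite poweR0r ?invr_eq0 ?gt_eqF//.
  by apply: integral_ge0 => t _; exact: poweR_ge0.
pose H (z : T * measurableTypeR R) := (\1_S z * (f z.1 `^ (r - 1) * W z.1))%:E.
have mH : measurable_fun setT H.
  apply/measurable_EFinP; apply: measurable_funM; first exact: measurable_indic.
  exact: (measurableT_comp mg).
have H0 z : 0 <= H z by rewrite lee_fin mulr_ge0// mulr_ge0 ?powR_ge0.
have AE : A = \int[mu]_x \int[lebesgue_measure]_t H (x, t).
  apply: eq_integral => x _.
  rewrite /H /=; under eq_integral do rewrite mulrC EFinM.
  rewrite ge0_integralZl_EFin//; last 2 first.
  - apply/measurable_EFinP.
    by apply: measurableT_comp => //; exact: measurable_indic.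
  - by rewrite mulr_ge0 ?powR_ge0.
  rewrite (_ : (fun t => _) = (fun t : measurableTypeR R => (\1_(`]0%R, f x[%classic) t)%:E)); last first.
    apply/funext => t; rewrite !indicE.
    rewrite (_ : ((x, t) \in S) = (t \in `]0%R, f x[%classic))//.
    apply/idP/idP; rewrite !inE /S /= in_itv /=; first by move=> [-> ->].
    by move=> /andP[].
  rewrite integral_indic//.
  rewrite setIT /= lebesgue_measure_itv /= lte_fin.
  case: ifPn => [fx0|].
    rewrite oppr0 adde0 -EFinM; congr (_%:E).
    by rewrite mulrAC [(_ * f x)%R]mulrC mulr_powRB1.
  rewrite -leNgt => fx0; have -> : f x = 0%R by apply/eqP; rewrite eq_le fx0 f0.
  by rewrite powR0 ?gt_eqF// mul0r mule0.
have AB : A <= (\int[lebesgue_measure]_(t in `]0%R, +oo[)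
    (\int[mu]_x (\1_(E t) x * W x)%:E) `^ r^-1) * A `^ (1 - r^-1).
  rewrite {1}AE (fubini_tonelli (m1 := mu) (m2 := lebesgue_measure) H mH H0).
  rewrite -ge0_integralZr//; last 3 first.
  - exact: measurable_funTS.
  - by move=> t _; exact: poweR_ge0.
  - exact: poweR_ge0.
  rewrite [leRHS]integral_mkcond; apply: ge0_le_integral => //.
  - by move=> t _; apply: integral_ge0.
  - exact: (@measurable_fun_fubini_tonelli_G _ _ T (measurableTypeR R) R mu H mH H0).
  - apply/(measurable_restrictT _ _).1 => //.
    apply: measurable_funTS; apply: emeasurable_funM => //.
  move=> t _; rewrite /patch; case: ifPn => [|tn].
    rewrite inE /= in_itv /= andbT => t0.
    apply: le_trans (weighted_hoelder (mE t)).
    rewrite le_eqVlt; apply/orP; left; apply/eqP; apply: eq_integral => x _.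
    rewrite /H /= !indicE (_ : (x \in E t) = ((x, t) \in S))//.
    by apply/idP/idP; rewrite !inE /S /E /= => // -[].
  rewrite integral0_eq// => x _; rewrite /H indicE memNset ?mul0r// => -[/= t0 _].
  by move: tn; rewrite notin_setE /= in_itv /= t0.
have Afn : A \is a fin_num by rewrite ge0_fin_numE.
have Ar0 : 0 < A `^ (1 - r^-1) by apply: poweR_gt0; rewrite lt_neqAle eq_sym AN0.
have Arfn : A `^ (1 - r^-1) \is a fin_num by exact: fin_num_poweR.
have AD : A = A `^ r^-1 * A `^ (1 - r^-1).
  rewrite -poweRD.
    by rewrite (_ : (r^-1 + (1 - r^-1) = 1)%R) ?poweRe1//; ring.
  apply: nneg_neq0_poweRD_def => //; first by rewrite invr_ge0 ltW.
  by rewrite subr_ge0 invf_le1.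
move: AB; rewrite {1}AD.
move: Arfn Ar0; case: (A `^ (1 - r^-1)) => // c _; rewrite lte_fin => c0.
by rewrite lee_pmul2r.
Qed.

End layer_cake.

(** * From the isoperimetric to the Sobolev inequality *)

Section levels.
Context {R : realType}.
Let Plane := (measurableTypeR R * measurableTypeR R)%type.
Variable u : R * R -> R.
Hypotheses (su : smooth u) (usupp : compactly_supported u).

(** Values of |u| at critical points are critical values of u or of - u. The
    value at the origin is excluded because the weight is not continuous there. *)
Lemma ae_regular_level : {ae @lebesgue_measure R, forall t, 0 < t ->
  (forall x, `|u x| = t -> grad u x != 0) /\ `|u 0| != t}.
Proof.
have u2 := su 2%N.
have N1 := sard u2; have N2 := sard (CkN u2).
have N3 : (@lebesgue_measure R).-negligible [set `|u 0|].
  by apply/negligibleP; [exact: measurable_set1|exact: lebesgue_measure_set1].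
apply: negligibleS (negligibleU (negligibleU N1 N2) N3) => t /= H.
apply: contrapT => nt; apply: H => t0; split; last first.
  by apply/eqP => ut; apply: nt; right.
move=> x ux; apply/eqP => gx; apply: nt; left.
have [u0|u0] := leP 0 (u x).
  by left; exists x => //; rewrite -ux ger0_norm.
right; exists x; last by rewrite -ux ltr0_norm.
have [du _ _] := u2; rewrite /= /grad partial1N// partial2N//.
by move: gx => [p1 p2]; rewrite /= p1 p2 oppr0.
Qed.

Lemma bounded_superlevel (t : R) : 0 < t -> bounded_set [set x | t < `|u x|].
Proof.
move=> t0; have [M [Mr HM]] := compact_bounded usupp.
exists M; split => // N MN x /= tx; apply: (HM _ MN).
by apply: (@subset_closure _ [set x | u x != 0]); rewrite /= -normr_gt0 (lt_trans t0).
Qed.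

Lemma compactly_supported_bounded : exists2 B : R, 0 <= B & forall x, `|u x| <= B.
Proof.
have cu := su 0%N.
have cK : compact (u @` closure [set x | u x != 0]).
  by apply: continuous_compact usupp; exact: continuous_subspaceT.
have [M [_ HM]] := compact_bounded cK.
have M1 : M < `|M| + 1 by rewrite (le_lt_trans (ler_norm M))// ltrDl.
exists (`|M| + 1) => // x; have [->|ux] := eqVneq (u x) 0; first by rewrite normr0.
apply: (HM _ M1); exists x => //.
exact: (@subset_closure _ [set x | u x != 0]).
Qed.

Local Open Scope ereal_scope.

Lemma weighted_power_lty (W : R * R -> R) (r n : R) :
  (0 < r)%R -> measurable_fun [set: Plane] (W : Plane -> measurableTypeR R) ->
  (forall x, 0 <= W x <= n)%R ->
  \int[lebesgue2]_x (`|u x| `^ r * W x)%:E < +oo.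
Proof.
move=> r0 mW Wn; have [M M0 HM] := supp_square usupp.
have [B B0 HB] := compactly_supported_bounded.
have M20 : (0 < 2 * M)%R by rewrite mulr_gt0.
have n0 : (0 <= n)%R by have /andP[] := Wn 0%R; exact: le_trans.
have mu_ : measurable_fun [set: Plane] ((fun x => `|u x|%R) : Plane -> measurableTypeR R).
  by apply: continuous_measurable_plane => x; apply: cvg_norm; exact: (su 0%N).
pose Q : set Plane := square (- M, - M)%R (2 * M)%R.
have mQ : measurable Q by exact: measurable_square.
apply: (@le_lt_trans _ _ (\int[lebesgue2]_x (B `^ r * n * \1_Q x)%:E)).
  apply: ge0_le_integral => //.
  - by move=> x _; rewrite lee_fin mulr_ge0 ?powR_ge0//; have /andP[] := Wn x.
  - apply/measurable_EFinP; apply: measurable_funM => //.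
    exact: (measurableT_comp (measurable_powR r)).
  - by apply/measurable_EFinP; apply: measurable_funM.
  move=> x _; rewrite lee_fin indicE.
  have [ux|ux] := eqVneq (u x) 0%R.
    by rewrite ux normr0 powR0 ?gt_eqF// mul0r !mulr_ge0 ?powR_ge0.
  have xQ : Q x by exact: HM.
  rewrite mem_set// mulr1; have /andP[W0 Wx] := Wn x.
  apply: ler_pM; [exact: powR_ge0|exact: W0| |exact: Wx].
  by apply: ge0_ler_powR; rewrite ?nnegrE// ltW.
under eq_integral do rewrite EFinM.
rewrite ge0_integralZl_EFin//; last 2 first.
- by apply/measurable_EFinP; exact: measurable_indic.
- by rewrite mulr_ge0 ?powR_ge0.
rewrite integral_indic// setIT.
have -> : lebesgue2 Q = ((2 * M) ^+ 2)%:E by exact: lebesgue2_square.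
by rewrite -EFinM ltry.
Qed.

End levels.

Section isoperimetric_to_sobolev.
Context {R : realType}.
Let Plane := (measurableTypeR R * measurableTypeR R)%type.
Variables (p q r C : R) (u : R * R -> R).
Hypotheses (r1 : 1 <= r) (su : smooth u) (usupp : compactly_supported u).
Local Open Scope ereal_scope.
Hypothesis isoperimetric : forall A : set (R * R), bounded_set A -> smooth_set A ->
  (\int[lebesgue2]_(x in A) (enorm x `^ q)%:E) `^ r^-1 <=
  C%:E * \int[hausdorff1_measure]_(x in boundary A) (enorm x `^ p)%:E.

Let r0 : (0 < r)%R.
Proof. exact: lt_le_trans r1. Qed.

Let E (t : R) : set Plane := [set x | (t < `|u x|)%R].
Let dens x := (enorm x `^ p * enorm (grad u x))%:E.

Let mE t : measurable (E t).
Proof. by apply: open_measurable_plane; apply: open_superlevel; exact: (su 0%N). Qed.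

Lemma regular_level_isoperimetric (t : R) : (0 < t)%R ->
  (forall x, `|u x|%R = t -> grad u x != 0%R) ->
  (\int[lebesgue2]_(x in E t) (enorm x `^ q)%:E) `^ r^-1 <=
  C%:E * \int[hausdorff1_measure]_(x in boundary (E t)) (enorm x `^ p)%:E.
Proof.
move=> t0 reg; apply: isoperimetric; first exact: bounded_superlevel.
exact: smooth_superlevel.
Qed.

(** By Sard's theorem some superlevel set is nonempty, open and smooth, so its
    weighted area is positive, while a negative C would make the other side of
    the isoperimetric inequality nonpositive. *)
Lemma isoperimetric_constant_ge0 x : u x != 0%R -> (0 <= C)%R.
Proof.
move=> ux; have cu : continuous u := su 0%N.
have [y [uy y0]] : exists y, u y != 0%R /\ y != 0%R.
  have [x0|x0] := eqVneq x 0%R; last by exists x.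
  have cx : u z @[z --> x] --> u x by exact: cu.
  have nx : \forall z \near nbhs x, u z != 0%R by exact: (cvgr_neq0 _ cx).
  have [e [e0 He]] := filter_ex (filterI (nbhs_right_gt 0%R) (near_ball_sub nx)).
  have e20 : (0 < e / 2)%R by rewrite divr_gt0.
  exists (e / 2, 0)%R; split; last by apply/eqP => -[/eqP]; rewrite gt_eqF.
  apply: He; rewrite x0; apply/ball_prodE; rewrite /= !sub0r oppr0 normr0 normrN gtr0_norm//.
  by split => //; rewrite [ltRHS]splitr ltrDl.
pose s := `|u y|%R; have s0 : (0 < s)%R by rewrite normr_gt0.
have [t [t0 ts reg]] : exists t, [/\ (0 < t)%R, (t < s)%R &
    forall x, `|u x|%R = t -> grad u x != 0%R].
  have [N [mN N0 HN]] := ae_regular_level su.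
  apply: contrapT => nt; have : `]0%R, s[%classic `<=` N.
    move=> t /=; rewrite in_itv /= => /andP[t0 ts]; apply: HN => /= H.
    by apply: nt; exists t; split => //; have [] := H t0.
  move=> sN; have : @lebesgue_measure R `]0%R, s[%classic <= 0.
    rewrite -N0; apply: le_measure => //; rewrite inE //; exact: measurable_itv.
  rewrite lebesgue_measure_itv /= lte_fin s0 oppr0 adde0 lee_fin.
  by rewrite leNgt s0.
have nE : \forall z \near nbhs y, E t z.
  by apply: open_nbhs_nbhs; split => //; exact: open_superlevel.
have wy : (0 < enorm y `^ q)%R by rewrite powR_gt0// enorm_gt0.
have cw : (enorm z `^ q)%R @[z --> y] --> (enorm y `^ q)%R by exact: continuous_weight.
have nw : \forall z \near nbhs y, (enorm y `^ q / 2 < enorm z `^ q)%R.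
  by apply: (cvgr_gt _ cw); rewrite [ltRHS]splitr ltrDl divr_gt0.
have [e [e0 [eE ew]]] := filter_ex (filterI (nbhs_right_gt 0%R)
  (filterI (near_ball_sub nE) (near_ball_sub nw))).
have Qe z : square y e z -> ball y e z.
  by move=> zQ; apply: (square_ball (c := y)) => // b; rewrite lexx ltrDl.
have mQ : measurable (square y e : set Plane) by exact: measurable_square.
have mw A : measurable_fun (A : set Plane) (fun z => (enorm z `^ q)%:E).
  by apply: measurable_funTS; apply/measurable_EFinP; exact: measurable_weight.
have pos : 0 < \int[lebesgue2]_(z in E t) (enorm z `^ q)%:E.
  apply: (@lt_le_trans _ _ (\int[lebesgue2]_(z in square y e) (enorm y `^ q / 2)%:E)).
    rewrite integral_cst// (lebesgue2_square y e0) -EFinM lte_fin.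
    by rewrite mulr_gt0 ?divr_gt0 ?exprn_gt0.
  apply: (@le_trans _ _ (\int[lebesgue2]_(z in square y e) (enorm z `^ q)%:E)).
    apply: ge0_le_integral => //.
    - by move=> z _; rewrite lee_fin divr_ge0// ltW.
    - by move=> z /Qe/ew; rewrite lee_fin => /ltW.
  apply: ge0_subset_integral => //.
  - by move=> z _; rewrite lee_fin powR_ge0.
  - by move=> z /Qe; exact: eE.
rewrite leNgt; apply/negP => C0.
have := regular_level_isoperimetric t0 reg; rewrite leNgt => /negP; apply.
apply: (@le_lt_trans _ _ 0); last exact: poweR_gt0.
apply: mule_le0_ge0; first by rewrite lee_fin ltW.
by apply: integral_ge0 => z _; rewrite lee_fin powR_ge0.
Qed.

Hypothesis C0 : (0 <= C)%R.

(** Truncating |x|^q makes the norm finite, as [minkowski_layer_cake] requires.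
    The superlevel sets of |u| are the layers, the isoperimetric inequality
    bounds the norms of almost all of them, and the coarea inequality bounds the
    integral of the perimeters. *)
Lemma truncated_bound (n : nat) (eps : R) : (0 < eps)%R ->
  (\int[lebesgue2]_x (`|u x| `^ r * Num.min (enorm x `^ q) n%:R)%:E) `^ r^-1 <=
  C%:E * ((1 + eps)%:E * \int[lebesgue2]_x dens x).
Proof.
move=> eps0; pose W x := Num.min (enorm x `^ q)%R n%:R.
have mW : measurable_fun [set: Plane] (W : Plane -> measurableTypeR R).
  apply: measurable_minr; last exact: measurable_cst.
  exact: measurable_weight.
have W0 x : (0 <= W x)%R by rewrite le_min powR_ge0/=.
have mf : measurable_fun [set: Plane] ((fun x => `|u x|%R) : Plane -> measurableTypeR R).
  by apply: continuous_measurable_plane => x; apply: cvg_norm; exact: (su 0%N).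
have fin : \int[lebesgue2]_x (`|u x| `^ r * W x)%:E < +oo.
  apply: (@weighted_power_lty _ _ su usupp W r n%:R r0 mW) => x.
  by rewrite W0 ge_min lexx orbT.
have [le1 mphi] := @minkowski_layer_cake _ Plane R
  (sigma_finite_measure_of (@sigma_finite_lebesgue2 R))
  (fun x => `|u x|%R) W r mf mW (fun x => normr_ge0 _) W0 r1 fin.
apply: le_trans le1 _.
have [J [mJ J0 intJ HJ]] := @coarea_inequality R u (fun x => enorm x `^ p)%R eps
  (su 1%N) usupp eps0 (fun x => powR_ge0 _ _) (measurable_weight p).
apply: (@le_trans _ _ (\int[lebesgue_measure]_(t in `]0%R, +oo[) (C%:E * J t))).
  apply: ae_ge0_le_integral => //.
  - by move=> t _; exact: poweR_ge0.
  - exact: measurable_funTS.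
  - by move=> t _; rewrite mule_ge0.
  - by apply: measurable_funTS; exact: measurable_funeM.
  apply: negligibleS (ae_regular_level su) => t; apply: contra_not => /= Ht.
  rewrite /= in_itv /= andbT => t0; have [reg u0] := Ht t0.
  apply: (@le_trans _ _ ((\int[lebesgue2]_(x in E t) (enorm x `^ q)%:E) `^ r^-1)).
    apply: gt0_ler_poweR; first by rewrite invr_ge0 ltW.
    + by rewrite in_itv /= leey andbT integral_ge0// => x _; rewrite lee_fin mulr_ge0.
    + by rewrite in_itv /= leey andbT integral_ge0// => x _; rewrite lee_fin powR_ge0.
    rewrite [leRHS]integral_mkcond; apply: ge0_le_integral.
    + exact: measurableT.
    + by move=> x _; rewrite lee_fin mulr_ge0.
    + by apply/measurable_EFinP; apply: measurable_funM; [apply: measurable_indic; exact: mE|exact: mW].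
    + apply: (measurable_restrictT _ (mE t)).1.
      by apply: measurable_funTS; apply/measurable_EFinP; exact: measurable_weight.
    move=> x _; rewrite /patch indicE; case: ifPn => _; last by rewrite mul0r.
    by rewrite mul1r lee_fin ge_min lexx.
  apply: le_trans (regular_level_isoperimetric t0 reg) _.
  apply: lee_wpmul2l; first by rewrite lee_fin.
  apply: HJ => // [x|x ux]; first by apply: boundary_superlevel; exact: (su 0%N).
  have x0 : x != 0%R by apply: contra u0 => /eqP <-; rewrite ux.
  split; [exact: reg|by rewrite powR_gt0// enorm_gt0|exact: continuous_weight].
apply: (@le_trans _ _ (\int[lebesgue_measure]_t (C%:E * J t))).
  apply: ge0_subset_integral => //; first exact: measurable_funeM.
  by move=> t _; rewrite mule_ge0.
rewrite ge0_integralZl_EFin//.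
by apply: lee_wpmul2l => //; rewrite lee_fin.
Qed.

Lemma le_epsilon_mul (a y : \bar R) : 0 <= y ->
  (forall eps : R, (0 < eps)%R -> a <= (1 + eps)%:E * y) -> a <= y.
Proof.
case: y => [y| |]//; last by move=> _ _; rewrite leey.
rewrite lee_fin => y0 H; apply/lee_addgt0Pr => e e0.
have y1 : (0 < y + 1)%R by rewrite ltr_wpDl.
apply: le_trans (H (e / (y + 1))%R _) _; first by rewrite divr_gt0.
rewrite -EFinM -EFinD lee_fin mulrDl mul1r lerD2l.
by rewrite -mulrA ger_pMr// mulrC ler_pdivrMr// mul1r lerDl.
Qed.

(** Remove the truncation by Fatou's lemma. *)
Lemma sobolev_power : (\int[lebesgue2]_x (`|u x| `^ r * enorm x `^ q)%:E) `^ r^-1 <=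
  C%:E * \int[lebesgue2]_x dens x.
Proof.
have D0 : 0 <= \int[lebesgue2]_x dens x.
  by apply: integral_ge0 => x _; rewrite lee_fin mulr_ge0 ?powR_ge0 ?enorm_ge0.
set S := C%:E * _; have S0 : 0 <= S by rewrite mule_ge0// lee_fin.
pose A n := \int[lebesgue2]_x (`|u x| `^ r * Num.min (enorm x `^ q) n%:R)%:E.
have A0 n : 0 <= A n.
  by apply: integral_ge0 => x _; rewrite lee_fin mulr_ge0 ?powR_ge0// le_min powR_ge0 /=.
have AS n : A n <= S `^ r.
  have H : A n `^ r^-1 <= S.
    apply: le_epsilon_mul => // eps eps0; apply: le_trans (truncated_bound n eps0) _.
    by rewrite muleCA.
  rewrite -(poweRe1 (A0 n)) -(@mulVf _ r) ?gt_eqF// poweRrM.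
  by apply: gt0_ler_poweR => //; rewrite ?in_itv /= ?leey ?andbT ?poweR_ge0// ltW.
have : \int[lebesgue2]_x (`|u x| `^ r * enorm x `^ q)%:E <= S `^ r.
  have mf : measurable_fun [set: Plane] ((fun x => `|u x| `^ r)%R : Plane -> measurableTypeR R).
    apply: (measurableT_comp (measurable_powR r)).
    by apply: continuous_measurable_plane => x; apply: cvg_norm; exact: (su 0%N).
  have mA n : measurable_fun [set: Plane] (fun x => (`|u x| `^ r * Num.min (enorm x `^ q) n%:R)%:E).
    apply/measurable_EFinP; apply: measurable_funM => //.
    by apply: measurable_minr; [exact: measurable_weight|exact: measurable_cst].
  apply: (@le_trans _ _ (\int[lebesgue2]_x limn_einf
      (fun n => (`|u x| `^ r * Num.min (enorm x `^ q) n%:R)%:E))).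
    apply: ge0_le_integral => //.
    - by move=> x _; rewrite lee_fin mulr_ge0 ?powR_ge0.
    - apply/measurable_EFinP; apply: measurable_funM => //.
      exact: measurable_weight.
    - exact: measurable_limn_einf.
    move=> x _; apply: limn_einf_ge.
    exists (Num.truncn (enorm x `^ q)).+1 => // n /= xn; rewrite lee_fin min_l//.
    apply: le_trans (ltW (truncnS_gt _)) _.
    by rewrite ler_nat.
  apply: le_trans (fatou _ _ _ _) _ => //.
    by move=> n x _; rewrite lee_fin mulr_ge0 ?powR_ge0// le_min powR_ge0 /=.
  exact: limn_einf_le.
move=> H; rewrite -(poweRe1 S0) -(@mulfV _ r) ?gt_eqF// poweRrM.
apply: gt0_ler_poweR => //; rewrite ?in_itv /= ?leey ?andbT ?poweR_ge0//.
  by rewrite invr_ge0 ltW.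
by apply: integral_ge0 => x _; rewrite lee_fin mulr_ge0 ?powR_ge0.
Qed.

End isoperimetric_to_sobolev.

Unset Implicit Arguments.
Set Strict Implicit.
Set Printing Implicit Defensive.

Theorem proposition5 (R : realType) (p q : R) (hp : -1 < p) (hq : -2 < q)
    (r := (q + 2) / (p + 1)) (hr : 1 <= r) (C : R)
    (hC : forall Omega : set (R * R), bounded_set Omega -> smooth_set Omega ->
      ((\int[lebesgue2]_(x in Omega) (enorm x `^ q)%:E) `^ ((p + 1) / (q + 2))
       <= C%:E * \int[hausdorff1_measure]_(x in boundary Omega)
                   (enorm x `^ p)%:E)%E)
    (gamma := q / r) (alpha := p)
    (u : R * R -> R) (hu : smooth u) (hsupp : compactly_supported u) :
  ('N[lebesgue2]_(r%:E)[(fun x => (u x * enorm x `^ gamma)%:E)]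
   <= C%:E * 'N[lebesgue2]_1[(fun x => (enorm (grad u x) * enorm x `^ alpha)%:E)])%E.
Proof.
have p10 : 0 < p + 1 by rewrite -ltrBlDr sub0r.
have r0 : 0 < r by exact: lt_le_trans hr.
have rV : (p + 1) / (q + 2) = r^-1 by rewrite /r invf_div.
rewrite Lnorm1.
have -> : (\int[lebesgue2]_x `|(enorm (grad u x) * enorm x `^ alpha)%:E|)%E =
    (\int[lebesgue2]_x (enorm x `^ p * enorm (grad u x))%:E)%E.
  apply: eq_integral => x _.
  by rewrite abse_EFin ger0_norm ?mulr_ge0 ?enorm_ge0 ?powR_ge0// mulrC.
have -> : ('N[lebesgue2]_(r%:E)[(fun x => (u x * enorm x `^ gamma)%:E)] =
    (\int[lebesgue2]_x (`|u x| `^ r * enorm x `^ q)%:E) `^ r^-1)%E.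
  rewrite unlock; apply: (congr1 (fun z => poweR z r^-1)); apply: eq_integral => x _.
  rewrite abse_EFin poweR_EFin normrM powRM// [ `|enorm x `^ _| ]ger0_norm ?powR_ge0//.
  by rewrite -powRrM /gamma divfK// gt_eqF.
have iso A : bounded_set A -> smooth_set A ->
    ((\int[lebesgue2]_(x in A) (enorm x `^ q)%:E) `^ r^-1 <=
    C%:E * \int[hausdorff1_measure]_(x in boundary A) (enorm x `^ p)%:E)%E.
  by move=> bA sA; rewrite -rV; exact: hC.
have [[x ux]|/forallNP u0] := pselect (exists x, u x != 0).
  have C0 : 0 <= C := isoperimetric_constant_ge0 hu hsupp iso ux.
  exact: (sobolev_power hr hu hsupp iso C0).
have {}u0 : u = cst 0 by apply/funext => x; apply/eqP/negPn/negP/u0.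
rewrite !integral0_eq.
- by rewrite mule0 poweR0r// invr_eq0 gt_eqF.
- move=> x _; have g0 : grad u x = 0 by rewrite u0 /grad /partial1 /partial2 !derive_cst.
  by rewrite g0; move: (enorm_eq0 (0 : R * R)); rewrite eqxx => /eqP ->; rewrite mulr0.
- by move=> x _; rewrite u0 /= normr0 powR0 ?gt_eqF// mul0r.
Qed.
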